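(* Let $\mathcal{G}=(V,\mathcal{E})$ be a hypergraph, $S$ a multiset of vertices of $V$, $\alpha,\beta\in\mathbb{Z}_+$, $f,g:V\to\mathbb{Z}_+$ functions, and $\mathsf{M}=(S,r_{\mathsf{M}})$ a matroid. There exists an $\mathsf{M}$-based $(f,g)$-bounded $(\alpha,\beta)$-limited packing of rooted hypertrees in $\mathcal{G}$ if and only if all of the following hold: (i) $f(v)\le\min\{r_{\mathsf{M}}(S_v),g(v)\}$ for every $v\in V$; (ii) $\alpha\le\beta$; (iii) $\alpha\le\sum_{v\in V}\min\{r_{\mathsf{M}}(S_v),g(v)\}$; (iv) $e_{\mathcal{E}}(\mathcal{P})\ge\sum_{X\in\mathcal{P}}\max\{r_{\mathsf{M}}(S)-r_{\mathsf{M}}(S_Y)-g(X\setminus Y):Y\subseteq X\}$ for every partition $\mathcal{P}$ of $V$; (v) $\beta+e_{\mathcal{E}}(\mathcal{P})\ge\sum_{X\in\mathcal{P}}\max\{r_{\mathsf{M}}(S)-r_{\mathsf{M}}(S_Y)+f(Y):Y\subseteq X\}$ for every partition $\mathcal{P}$ of $V$.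
   Context: Hyperedges are subsets of $V$ of size at least two (multiplicities allowed); $e_{\mathcal{E}}(\mathcal{P})$ is the number of hyperedges of $\mathcal{E}$ not contained in a single member of the partition $\mathcal{P}$. Trimming a hyperedge $Z$ means replacing it by an edge with two distinct end-vertices in $Z$. $\mathbb{Z}_+$ is the non-negative integers; $h(X)=\sum_{x\in X}h(x)$. A multiset $S$ of vertices is a finite collection of vertices with multiplicities; $S_X$ is the set of elements of $S$ located in $X$, $S_v=S_{\{v\}}$; $r_{\mathsf{M}}$ is the rank function of $\mathsf{M}$. In a graph, a rooted tree is a tree (possibly a single vertex) with a designated root, a packing is a collection of pairwise edge-disjoint rooted trees; it is $\mathsf{M}$-based if each tree's root is assigned a distinct element of $S$ located at the root vertex and for every vertex $v$ the set of root-elements of the trees containing $v$ is a basis of $\mathsf{M}$; $(f,g)$-bounded if every $v$ is the root of at least $f(v)$ and at most $g(v)$ trees; $(\alpha,\beta)$-limited if the total number of roots is between $\alpha$ and $\beta$. A packing of rooted hypertrees in $\mathcal{G}$ is a collection of pairs (root vertex, set of hyperedges of $\mathcal{E}$), the hyperedge sets pairwise disjoint, such that the hyperedges can be trimmed so that this collection becomes a packing of rooted trees; the packing of rooted hypertrees is $\mathsf{M}$-based, $(f,g)$-bounded, $(\alpha,\beta)$-limited if it can be trimmed to a packing of rooted trees with these properties. *)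

(* Defs.v *)
From HB Require Import structures.
From mathcomp Require Import all_boot all_order all_algebra.

Set Implicit Arguments.
Unset Strict Implicit.
Unset Printing Implicit Defensive.

Import Order.TTheory GRing.Theory Num.Theory.

Record matroid (S : finType) := Matroid {
  rk : {set S} -> nat;
  rk_card : forall A, rk A <= #|A|;
  rk_mono : forall A B : {set S}, A \subset B -> rk A <= rk B;
  rk_submod : forall A B : {set S}, rk (A :|: B) + rk (A :&: B) <= rk A + rk B
}.

Definition indep (S : finType) (M : matroid S) (A : {set S}) : bool :=
  rk M A == #|A|.

Definition basis (S : finType) (M : matroid S) (B : {set S}) : bool :=
  maxset (indep M) B.

(* The hyperedges are indexed by a finite type, so that the same vertex set may
   occur several times. *)
Record hypergraph (V : finType) := Hypergraph {
  hedge : finType;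
  hverts : hedge -> {set V};
  hverts_size : forall e, 1 < #|hverts e|
}.

Definition cross (V : finType) (G : hypergraph V) (P : {set {set V}}) : nat :=
  #|[set e : hedge G | ~~ [exists X in P, hverts e \subset X]]|.

(* A multiset of vertices is given by a finite type S of elements together with
   the map loc sending each element to the vertex at which it is located. *)
Definition located (V S : finType) (loc : S -> V) (X : {set V}) : {set S} :=
  [set s | loc s \in X].

Definition vsum (V : finType) (h : V -> nat) (X : {set V}) : nat :=
  \sum_(x in X) h x.

(* Since set0 \subset X, the starting value h set0 is one of the values over
   which the maximum is taken. *)
Definition max_sub (V : finType) (X : {set V}) (h : {set V} -> int) : int :=
  \big[Num.max/h set0]_(Y : {set V} | Y \subset X) h Y.

Section Graph.

(* A loopless multigraph on V with edge type E is a map ends : E -> {set V} all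
   of whose values have two elements; see trimming below. *)
Variables (V E : finType) (ends : E -> {set V}).

Definition joins (e : E) (x y : V) : bool := ends e == [set x; y].

Definition adj (F : {set E}) : rel V :=
  fun x y => [exists e in F, joins e x y].

(* A cycle is a nonempty cyclic sequence (x_1, e_1), ..., (x_n, e_n) of distinct
   vertices x_i and distinct edges e_i, where e_i joins x_i to x_(i+1).  Two
   parallel edges form a cycle with n = 2. *)
Definition acyclic (F : {set E}) : Prop :=
  forall c : seq (V * E),
    c != [::] -> uniq (unzip1 c) -> uniq (unzip2 c) ->
    all (fun e => e \in F) (unzip2 c) ->
    ~~ cycle (fun p q => joins p.2 p.1 q.1) c.

(* A pair T = (x, F) stands for the graph with edge set F whose vertices are the
   root x and the ends of the edges of F. *)
Definition tverts (T : V * {set E}) : {set V} :=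
  T.1 |: \bigcup_(e in T.2) ends e.

Definition rooted_tree (T : V * {set E}) : Prop :=
  (forall y, y \in tverts T -> connect (adj T.2) T.1 y) /\ acyclic T.2.

(* Collections of trees are families indexed by 'I_k: the same pair, for example
   the one-vertex tree (x, set0), may occur several times. *)
Definition tree_packing (k : nat) (P : 'I_k -> V * {set E}) : Prop :=
  (forall i, rooted_tree (P i)) /\
  (forall i j, i != j -> [disjoint (P i).2 & (P j).2]).

Definition based (S : finType) (loc : S -> V) (M : matroid S)
    (k : nat) (P : 'I_k -> V * {set E}) : Prop :=
  exists a : 'I_k -> S,
    [/\ injective a,
        forall i, loc (a i) = (P i).1 &
        forall v, basis M [set a i | i : 'I_k & v \in tverts (P i)]].

End Graph.

Definition bounded (V E : finType) (f g : V -> nat)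
    (k : nat) (P : 'I_k -> V * {set E}) : Prop :=
  forall v, f v <= #|[set i | (P i).1 == v]| <= g v.

Definition limited (V E : finType) (alpha beta : nat)
    (k : nat) (P : 'I_k -> V * {set E}) : Prop :=
  alpha <= k <= beta.

Definition trimming (V : finType) (G : hypergraph V)
    (t : hedge G -> {set V}) : Prop :=
  forall e, t e \subset hverts e /\ #|t e| = 2.

Definition based_bounded_limited_hypertree_packing
    (V : finType) (G : hypergraph V) (S : finType) (loc : S -> V)
    (M : matroid S) (f g : V -> nat) (alpha beta : nat)
    (k : nat) (P : 'I_k -> V * {set hedge G}) : Prop :=
  exists t : hedge G -> {set V},
    trimming t /\
    [/\ tree_packing t P, based t loc M P, bounded f g P &
        limited alpha beta P].

(* Main.v *)
Require Import Defs.
From HB Require Import structures.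
From mathcomp Require Import all_boot all_order all_algebra.
From mathcomp Require Import zify.

(* Necessity: in a tree, at least as many edges cross a partition as there are
   members met by the tree that do not contain its root.

   Sufficiency: write r for the rank of the matroid, i(X) for the number of
   hyperedges contained in X and S_Y for the elements located in Y.  One first
   chooses vectors m and b on the vertices (the numbers of hyperedges headed at
   v, and a bound on the number of roots at v) such that m(V) is the number of
   hyperedges, f <= b <= g, b(V) <= beta, and
     m(X) + b(X \ Y) >= r - r(S_Y) + i(X)   for all Y in X, X nonempty.
   In the variables m + b and b the slack of this system is intersecting
   submodular in the pair (X, Y); at a pair of vectors minimising m(V) the
   maximal tight pairs therefore form a partition of V, and (v), then (iv), for
   that partition bound the totals.  Hall's theorem turns m into a choice of
   heads.  A minimal set C of elements that keeps the inequalities true is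
   independent at each vertex and has at most b(v) elements there; adding
   elements achieves the lower bounds f and alpha.  Finally, as in the theorem
   of Durand de Gevigney, Nguyen and Szigeti on matroid-based packings of
   arborescences, the trees are grown by one leaf at a time, keeping
   indegree(X) >= r - r(elements of the trees meeting X). *)

Set Implicit Arguments.
Unset Strict Implicit.
Unset Printing Implicit Defensive.

Import Order.TTheory GRing.Theory Num.Theory.

(** * Matroid rank, closure and bases *)

Section Matroid.

Variables (S : finType) (M : matroid S).
Implicit Types (s : S) (A B D T : {set S}).

Lemma rk_set0 : rk M set0 = 0.
Proof. by have := rk_card M set0; rewrite cards0; lia. Qed.

Lemma rk_setU A B : rk M (A :|: B) <= rk M A + rk M B.
Proof. by have := rk_submod M A B; lia. Qed.

Lemma rk_setT A : rk M A <= rk M [set: S].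
Proof. exact: rk_mono (subsetT A). Qed.

(* [rk M (s |: A) <= rk M A] says that s lies in the closure of A. *)
Lemma rk_closure_mono s A B :
  A \subset B -> rk M (s |: A) <= rk M A -> rk M (s |: B) <= rk M B.
Proof.
move=> sAB hA; have := rk_submod M (s |: A) B.
rewrite -setUA (setUidPr sAB).
have : rk M A <= rk M ((s |: A) :&: B).
  by apply: rk_mono; rewrite subsetI sAB subsetUr.
lia.
Qed.

(** An element in the closure of [A] is in the closure of every larger set, so the elements of [T]
    can be added one at a time without raising the rank. *)
Lemma rk_closureU A T :
  (forall s, s \in T -> rk M (s |: A) <= rk M A) -> rk M (A :|: T) <= rk M A.
Proof.
move: {2}#|T| (leqnn #|T|) => n; elim: n T => [|n IH] T.
  by rewrite leqn0 cards_eq0 => /eqP-> _; rewrite setU0.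
case: (set_0Vmem T) => [-> _ _|[s sT] leT hT]; first by rewrite setU0.
have hle : rk M (A :|: (T :\ s)) <= rk M A.
  apply: IH => [|x /setD1P[_ /hT] //]; by move: leT; rewrite (cardsD1 s) sT.
apply: leq_trans hle; rewrite -{1}(setD1K sT) setUCA.
exact: rk_closure_mono (subsetUl _ _) (hT s sT).
Qed.

Lemma rk_augment A B : rk M A < rk M B -> exists2 s, s \in B & rk M A < rk M (s |: A).
Proof.
move=> ltAB; apply/exists_inP; apply: contraLR ltAB => /exists_inPn noaug.
rewrite -leqNgt; apply: leq_trans (rk_mono M (subsetUr A B)) _.
by apply: rk_closureU => s /noaug; rewrite -leqNgt.
Qed.

Lemma indepW A B : A \subset B -> indep M B -> indep M A.
Proof.
move=> sAB /eqP iB; apply/eqP/anti_leq; rewrite rk_card /=.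
have := rk_setU A (B :\: A); have := rk_card M (B :\: A).
have -> : A :|: B :\: A = B by rewrite -{1}(setIidPr sAB) setID.
rewrite iB cardsD (setIidPr sAB).
by have := subset_leq_card sAB; lia.
Qed.

Lemma indepU1 s A : indep M A -> rk M A < rk M (s |: A) -> indep M (s |: A).
Proof.
move=> /eqP iA lt; apply/eqP/anti_leq; rewrite rk_card /= cardsU1.
by move: lt; rewrite iA; case: (s \in A) => /=; lia.
Qed.

(** An element outside the closure of [D :\ s] is outside the closure of every subset of it. Hence
    putting the elements of [T] back one by one raises the rank each time. *)
Lemma rk_coloops D T : T \subset D ->
  (forall s, s \in T -> rk M (D :\ s) < rk M D) -> rk M (D :\: T) + #|T| <= rk M D.
Proof.
move: {2}#|T| (leqnn #|T|) => n; elim: n T => [|n IH] T.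
  by rewrite leqn0 cards_eq0 => /eqP-> _ _; rewrite setD0 cards0 addn0.
case: (set_0Vmem T) => [-> _ _ _|[s sT] leT sTD hT]; first by rewrite setD0 cards0 addn0.
have sT1 := subset_trans (subsetDl T [set s]) sTD.
have := IH (T :\ s) _ sT1 (fun x hx => hT x (subsetP (subsetDl T [set s]) x hx)).
move: leT; rewrite (cardsD1 s T) sT add1n ltnS => leT /(_ leT).
suff : rk M (D :\: T) < rk M (D :\: (T :\ s)) by lia.
have sD := subsetP sTD s sT.
have -> : D :\: (T :\ s) = s |: (D :\: T).
  by apply/setP => x; rewrite !inE; case: eqP => [->|//]; rewrite sD.
rewrite ltnNge; apply/negP => h.
have sub : D :\: T \subset D :\ s by apply: setDS; rewrite sub1set.
by have := rk_closure_mono sub h; rewrite setD1K // leqNgt hT.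
Qed.

Lemma basisP A : reflect (indep M A /\ rk M A = rk M [set: S]) (basis M A).
Proof.
apply: (iffP maxsetP) => [[iA maxA]|[iA rA]]; split=> //.
  apply/anti_leq; rewrite rk_setT leqNgt /=; apply/negP => /rk_augment[s _ lt].
  have eqA := maxA _ (indepU1 iA lt) (subsetUr _ _).
  by rewrite eqA ltnn in lt.
move=> B /eqP iB sAB; apply/eqP; rewrite eq_sym eqEcard sAB -iB -(eqP iA) rA.
exact: rk_setT.
Qed.

Lemma card_basis A : basis M A -> #|A| = rk M [set: S].
Proof. by case/basisP=> /eqP <-. Qed.

End Matroid.

(** * Uncrossing tight pairs of nested sets *)

Section Uncrossing.

Variables (V : finType) (h : {set V} -> {set V} -> int).

Definition intersecting_submodular : Prop :=
  forall X1 Y1 X2 Y2 : {set V}, X1 :&: X2 != set0 -> Y1 \subset X1 -> Y2 \subset X2 ->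
    (h (X1 :|: X2) (Y1 :|: Y2) + h (X1 :&: X2) (Y1 :&: Y2) <= h X1 Y1 + h X2 Y2)%R.

Definition nested_nonneg : Prop :=
  forall X Y : {set V}, X != set0 -> Y \subset X -> (0 <= h X Y)%R.

Definition tight (X Y : {set V}) : bool :=
  [&& X != set0, Y \subset X & h X Y == 0%R].

Hypotheses (h_submod : intersecting_submodular) (h_ge0 : nested_nonneg).

(** The values at the union and at the intersection are nonnegative and add up to at most 0. *)
Lemma tight_uncross X1 Y1 X2 Y2 :
  X1 :&: X2 != set0 -> tight X1 Y1 -> tight X2 Y2 ->
  tight (X1 :|: X2) (Y1 :|: Y2) && tight (X1 :&: X2) (Y1 :&: Y2).
Proof.
move=> I0 /and3P[X10 sY1 /eqP t1] /and3P[X20 sY2 /eqP t2].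
have U0 : X1 :|: X2 != set0.
  by apply: contraNneq X10 => e; rewrite -subset0 -e subsetUl.
have sU := setUSS sY1 sY2; have sI := setISS sY1 sY2.
rewrite /tight U0 I0 sU sI /=.
have := h_submod I0 sY1 sY2; have := h_ge0 U0 sU; have := h_ge0 I0 sI.
by rewrite t1 t2 => *; apply/andP; split; lia.
Qed.

(** Take a tight pair above [X0] with [#|X| + #|Y|] largest: its union with a tight pair that meets
    it is tight again, so it already absorbs that pair. *)
Lemma tight_max X0 Y0 : tight X0 Y0 ->
  exists X Y, [/\ tight X Y, X0 \subset X &
    forall X' Y', tight X' Y' -> X :&: X' != set0 -> X' \subset X /\ Y' \subset Y].
Proof.
move=> t0; have X00 : X0 != set0 by case/and3P: t0.
pose p (Z : {set V} * {set V}) := (X0 \subset Z.1) && tight Z.1 Z.2.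
have p0 : p (X0, Y0) by rewrite /p /= subxx.
pose w (Z : {set V} * {set V}) := #|Z.1| + #|Z.2|.
case: (@arg_maxnP _ (X0, Y0) p w p0) => -[X Y] /andP[/= sX tXY] maxXY.
exists X, Y; split=> // X' Y' t' I0.
have /andP[tU _] := tight_uncross I0 tXY t'.
have := maxXY (X :|: X', Y :|: Y').
rewrite /p /= (subset_trans sX (subsetUl _ _)) tU /w /= => /(_ isT) le.
have leX := subset_leq_card (subsetUl X X'); have leY := subset_leq_card (subsetUl Y Y').
split; apply/setUidPl/eqP; rewrite eq_sym eqEcard subsetUl /=; lia.
Qed.

(** Two maximal tight pairs whose first sets meet absorb each other, so these first sets are
    pairwise disjoint. *)
Lemma tight_partition :
  (forall v, exists X Y, tight X Y /\ v \in X) ->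
  exists (P : {set {set V}}) (y : {set V} -> {set V}),
    [/\ partition P [set: V], forall X, X \in P -> tight X (y X) &
        forall X X' Y' v, X \in P -> tight X' Y' -> v \in X -> v \in Y' -> v \in y X].
Proof.
move=> cov.
pose mx X Y := tight X Y && [forall X', forall Y',
  tight X' Y' && (X :&: X' != set0) ==> (X' \subset X) && (Y' \subset Y)].
have mxE X Y X' Y' : mx X Y -> tight X' Y' -> X :&: X' != set0 ->
    X' \subset X /\ Y' \subset Y.
  case/andP=> _ /forallP/(_ X')/forallP/(_ Y')/implyP H t I0.
  by apply/andP/H; rewrite t.
have nI (X1 X2 : {set V}) (v : V) : v \in X1 -> v \in X2 -> X1 :&: X2 != set0.
  by move=> v1 v2; apply/set0Pn; exists v; rewrite inE v1.
(* The default [set0] is never reached on a member of the family, since each member has a witness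
   [Y]. *)
exists [set X | [exists Y, mx X Y]], (fun X => odflt set0 [pick Y | mx X Y]).
have yP X : X \in [set X | [exists Y, mx X Y]] -> mx X (odflt set0 [pick Y | mx X Y]).
  rewrite inE => /existsP[Y mY]; case: pickP => [//|/(_ Y)]; by rewrite mY.
split; first (apply/and3P; split).
- apply/eqP/setP => v; rewrite inE; apply/bigcupP.
  case: (cov v) => X0 [Y0 [t0 v0]].
  case: (tight_max t0) => X [Y [tXY sX maxXY]]; exists X; last exact: (subsetP sX).
  rewrite inE; apply/existsP; exists Y; rewrite /mx tXY /=.
  by apply/forallP => X'; apply/forallP => Y'; apply/implyP => /andP[t I]; apply/andP/maxXY.
- apply/trivIsetP => X1 X2; rewrite !inE => /existsP[Y1 m1] /existsP[Y2 m2].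
  apply: contraR => /pred0Pn[v /andP[/= v1 v2]].
  have /andP[t1 _] := m1; have /andP[t2 _] := m2.
  have [s1 _] := mxE _ _ _ _ m1 t2 (nI _ _ _ v1 v2).
  have [s2 _] := mxE _ _ _ _ m2 t1 (nI _ _ _ v2 v1).
  by rewrite eqEsubset s1 s2.
- by rewrite inE; apply/existsP => -[Y /andP[/and3P[]]]; rewrite eqxx.
- by move=> X /yP /andP[].
move=> X X' Y' v /yP mX t' vX vY'.
have vX' : v \in X' by case/and3P: t' => _ /subsetP/(_ v vY').
by have [_ /subsetP] := mxE _ _ _ _ mX t' (nI _ _ _ vX vX'); apply.
Qed.

End Uncrossing.

(** * Sums over vertex sets, induced hyperedges and located elements *)

Section VertexSums.

Variable V : finType.
Implicit Types (h b : V -> nat) (X Y : {set V}).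

Lemma vsum_mkcond h X : vsum h X = \sum_x (x \in X) * h x.
Proof. by rewrite /vsum big_mkcond; apply: eq_bigr => x _; case: (x \in X); rewrite ?mul1n. Qed.

Lemma vsum0 h : vsum h set0 = 0.
Proof. by rewrite /vsum big_set0. Qed.

Lemma vsum1 h v : vsum h [set v] = h v.
Proof. by rewrite /vsum big_set1. Qed.

Lemma vsumUI h X Y : vsum h (X :|: Y) + vsum h (X :&: Y) = vsum h X + vsum h Y.
Proof.
rewrite !vsum_mkcond -!big_split /=; apply: eq_bigr => x _.
by rewrite !inE; case: (x \in X); case: (x \in Y); rewrite ?mul0n ?mul1n ?addn0.
Qed.

Lemma vsumD h X Y : Y \subset X -> vsum h Y + vsum h (X :\: Y) = vsum h X.
Proof.
move=> sYX; have := vsumUI h Y (X :\: Y).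
have -> : Y :|: X :\: Y = X by rewrite -{1}(setIidPr sYX) setID.
have -> : Y :&: (X :\: Y) = set0 by apply/setP => v; rewrite !inE; case: (v \in Y).
by rewrite vsum0 addn0 => <-.
Qed.

Lemma vsumT h : vsum h [set: V] = \sum_v h v.
Proof. by rewrite /vsum; apply: eq_bigl => v; rewrite inE. Qed.

Lemma vsum_partition h (P : {set {set V}}) :
  partition P [set: V] -> \sum_(X in P) vsum h X = vsum h [set: V].
Proof. by move=> pP; rewrite /vsum (set_partition_big _ pP). Qed.

Lemma vsum_incr h v X : vsum (fun x => h x + (x == v)) X = vsum h X + (v \in X).
Proof.
rewrite /vsum big_split /=; congr (_ + _); case vX: (v \in X).
  by rewrite (bigD1 v) //= eqxx big1 // => x /andP[_ /negPf ->].
by rewrite big1 // => x xX; case: eqP => // xv; rewrite -xv xX in vX.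
Qed.

Lemma vsum_decr h v X : 0 < h v -> vsum (fun x => h x - (x == v)) X + (v \in X) = vsum h X.
Proof.
move=> hv; rewrite -vsum_incr; apply: eq_bigr => x _.
by case: eqP => [->|_]; rewrite ?subn0 ?addn0 // subnK.
Qed.

Lemma vsumS h X Y : X \subset Y -> vsum h X <= vsum h Y.
Proof. by move/vsumD <-; apply: leq_addr. Qed.

End VertexSums.

Section Induced.

Variables (V E : finType) (H : E -> {set V}).
Implicit Types X Y : {set V}.

Definition induced (X : {set V}) : nat := #|[set e | H e \subset X]|.

Lemma induced_supermod X Y :
  induced X + induced Y <= induced (X :|: Y) + induced (X :&: Y).
Proof.
rewrite /induced -cardsUI leq_add //; apply: subset_leq_card; apply/subsetP => e.
  by rewrite !inE => /orP[] s; apply: subset_trans s _; rewrite ?subsetUl ?subsetUr.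
by rewrite !inE subsetI.
Qed.

Lemma inducedS X Y : X \subset Y -> induced X <= induced Y.
Proof.
by move=> s; apply: subset_leq_card; apply/subsetP => e; rewrite !inE => /subset_trans; apply.
Qed.

Lemma inducedT : induced [set: V] = #|E|.
Proof. by rewrite -cardsT; congr #|pred_of_set _|; apply/setP => e; rewrite !inE subsetT. Qed.

End Induced.

Lemma card_set_sum (T : finType) (p : pred T) : #|[set x | p x]| = \sum_x p x.
Proof. by rewrite -sum1dep_card big_mkcond; apply: eq_bigr => x _; case: (p x). Qed.

Section Located.

Variables (V S : finType) (loc : S -> V).
Implicit Types X Y : {set V}.

Lemma locatedU X Y : located loc (X :|: Y) = located loc X :|: located loc Y.
Proof. by apply/setP => s; rewrite !inE. Qed.

Lemma locatedI X Y : located loc (X :&: Y) = located loc X :&: located loc Y.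
Proof. by apply/setP => s; rewrite !inE. Qed.

Lemma located_sub X Y : X \subset Y -> located loc X \subset located loc Y.
Proof. by move/subsetP => s; apply/subsetP => x; rewrite !inE; apply: s. Qed.

Lemma rk_located_submod (M : matroid S) X Y :
  rk M (located loc (X :|: Y)) + rk M (located loc (X :&: Y))
    <= rk M (located loc X) + rk M (located loc Y).
Proof. by rewrite locatedU locatedI; apply: rk_submod. Qed.

End Located.

(** A hyperedge is nonempty and the members of [P] are disjoint, so it lies in one member or
    crosses, never both and never in two. *)
Lemma sum_induced_cross (V : finType) (G : hypergraph V) (P : {set {set V}}) :
  partition P [set: V] ->
  \sum_(X in P) induced (@hverts V G) X + cross G P = #|hedge G|.
Proof.
move=> pP; rewrite /cross card_set_sum.
under eq_bigr => X _ do rewrite /induced card_set_sum.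
rewrite exchange_big -big_split /= -sum1_card; apply: eq_bigr => e _.
case: (boolP [exists X in P, hverts e \subset X]) => [/exists_inP[X XP eX]|/exists_inPn no].
  rewrite addn0 (bigD1 X) //= eX big1 // => Y /andP[YP nYX]; apply/eqP; rewrite eqb0.
  apply: contra nYX => eY; have /card_gt0P[v ve] := ltnW (hverts_size e).
  have tP := partition_trivIset pP.
  by rewrite -(def_pblock tP XP (subsetP eX v ve)) (def_pblock tP YP (subsetP eY v ve)).
by rewrite big1 // => X /no /negPf ->.
Qed.

Lemma max_sub_geP (V : finType) (X Y : {set V}) (h : {set V} -> int) :
  Y \subset X -> (h Y <= max_sub X h)%R.
Proof. by move=> sY; rewrite /max_sub (bigD1 Y) //= le_max lexx. Qed.

Lemma max_sub_leP (V : finType) (X : {set V}) (h : {set V} -> int) (c : int) :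
  (forall Y : {set V}, Y \subset X -> (h Y <= c)%R) -> (max_sub X h <= c)%R.
Proof.
move=> le; apply: (big_ind (fun x => x <= c)%R) => //; first exact: le (sub0set X).
by move=> x y; rewrite ge_max => -> ->.
Qed.

(** * The vectors m and b, by descent to tight pairs *)

Section Descent.

Variables (V E S : finType) (H : E -> {set V}) (loc : S -> V) (M : matroid S).
Implicit Types (m b f g : V -> nat) (X Y : {set V}).

(* m is the sum of the head vector and the root vector b; this makes the slack
   submodular in the pair (X, Y). *)
Definition slack m b X Y : int :=
  ((vsum m X + rk M (located loc Y))%:Z
     - (rk M [set: S] + induced H X + vsum b Y)%:Z)%R.

Lemma slack_submod m b : intersecting_submodular (slack m b).
Proof.
move=> X1 Y1 X2 Y2 _ _ _; rewrite /slack.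
have := vsumUI m X1 X2; have := vsumUI b Y1 Y2.
have := induced_supermod H X1 X2; have := rk_located_submod loc M Y1 Y2.
lia.
Qed.

(* Decrease m, or increase b up to g, until every vertex is blocked by a tight
   pair; the maximal tight pairs then form the partition. *)
Lemma descent g m b :
  nested_nonneg (slack m b) -> (forall v, b v <= g v) ->
  exists m' b',
    [/\ nested_nonneg (slack m' b'), forall v, b v <= b' v <= g v,
        vsum m' [set: V] <= vsum m [set: V] &
        exists (P : {set {set V}}) (y : {set V} -> {set V}),
        [/\ partition P [set: V], forall X, X \in P -> y X \subset X &
          vsum m' [set: V] + \sum_(X in P) (rk M (located loc (y X)) + vsum g (X :\: y X))
           = \sum_(X in P) (rk M [set: S] + induced H X) + vsum b' [set: V]]].
Proof.
(* The induction measure m(V) + (g - b)(V) drops by one with each of the two moves. *)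
move: {2}(vsum m [set: V] + vsum (fun v => g v - b v) [set: V])
  (leqnn (vsum m [set: V] + vsum (fun v => g v - b v) [set: V])) => n.
elim/ltn_ind: n m b => n IH m b le_n h0 le_bg.
pose cov v := [exists X, exists Y, tight (slack m b) X Y && (v \in X)].
pose sat v := (b v == g v) || [exists X, exists Y, tight (slack m b) X Y && (v \in Y)].
(* If [v] is in no first set of a tight pair, all slacks at sets containing [v] are positive and
   [m v] may decrease by one. *)
case: (boolP [forall v, cov v]) => [/forallP covP|/forallPn[v ncov]]; last first.
  have nt X Y : tight (slack m b) X Y -> v \notin X.
    move=> t; apply: contra ncov => vX; apply/existsP; exists X.
    by apply/existsP; exists Y; rewrite t.
  have v0 : [set v] != set0 by apply/set0Pn; exists v; rewrite inE.
  have gap X Y : X != set0 -> Y \subset X -> v \in X -> (0 < slack m b X Y)%R.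
    move=> X0 sY vX; rewrite lt_neqAle h0 // andbT eq_sym.
    by apply: contraL vX => /eqP e; apply: nt (Y) _; rewrite /tight X0 sY e eqxx.
  (* The pair ({v}, {v}) has positive slack, which forces [m v] to be positive. *)
  have mv : 0 < m v.
    have := gap _ _ v0 (subxx _) (set11 v); rewrite /slack vsum1.
    by have := rk_setT M (located loc [set v]); lia.
  have [] := IH (vsum (fun x => m x - (x == v)) [set: V] + vsum (fun v => g v - b v) [set: V])
                 _ (fun x => m x - (x == v)) b (leqnn _) _ le_bg.
  - by have := vsum_decr [set: V] mv; rewrite inE /=; lia.
  - move=> X Y X0 sY; have := h0 X Y X0 sY; have := gap X Y X0 sY.
    rewrite /slack; have := vsum_decr X mv.
    by case: (v \in X) => /= e; [move/(_ isT) => g1 _ | move=> _]; lia.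
  move=> m' [b' [h1 h2 h3 h4]]; exists m', b'; split=> //.
  by apply: leq_trans h3 _; have := vsum_decr [set: V] mv; lia.
(* If [b v < g v] and [v] is in no second set of a tight pair, then [b v] may increase by one. *)
case: (boolP [forall v, sat v]) => [/forallP satP|/forallPn[v]]; last first.
  rewrite negb_or => /andP[nbg nt].
  have lt_bg : b v < g v by rewrite ltn_neqAle nbg le_bg.
  have [] := IH (vsum m [set: V] + vsum (fun x => g x - (b x + (x == v))) [set: V])
                 _ m (fun x => b x + (x == v)) (leqnn _).
  - suff : vsum (fun x => g x - (b x + (x == v))) [set: V] + 1
              = vsum (fun x => g x - b x) [set: V] by lia.
    rewrite -[1]/(nat_of_bool true) -(in_setT v) -vsum_incr.
    apply: eq_bigr => x _; case: eqP => [->|_]; lia.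
  - move=> X Y X0 sY; have := h0 X Y X0 sY; rewrite /slack vsum_incr.
    case: (boolP (v \in Y)) => /= [vY|_]; last lia.
    suff : slack m b X Y != 0%R by rewrite /slack; lia.
    apply: contra nt => /eqP e; apply/existsP; exists X; apply/existsP; exists Y.
    by rewrite /tight X0 sY e eqxx vY.
  - by move=> x; case: eqP => [->|_]; rewrite ?addn1 ?addn0.
  move=> m' [b' [h1 h2 h3 h4]]; exists m', b'; split=> // x.
  by case/andP: (h2 x) => lb ->; rewrite andbT (leq_trans _ lb) ?leq_addr.
exists m, b; split=> //; first by move=> v; rewrite leqnn le_bg.
have [|P [y [pP tP maxP]]] := tight_partition (slack_submod m b) h0.
  by move=> v; have /existsP[X /existsP[Y /andP[]]] := covP v; exists X, Y.
exists P, y; split=> //; first by move=> X /tP/and3P[].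
(* The equation is the sum of the tightness equations over [P]. A vertex of [X] outside [y X] is in
   no second set of a tight pair, so there [b] has reached [g]. *)
rewrite -!(vsum_partition _ pP) -!big_split /=; apply: eq_bigr => X XP.
have /and3P[_ sY /eqP tX] := tP X XP; move: tX; rewrite /slack.
have <- : vsum b (X :\: y X) = vsum g (X :\: y X).
  apply: eq_bigr => v /setDP[vX nvY].
  have /orP[/eqP //|/existsP[X' /existsP[Y' /andP[t' vY']]]] := satP v.
  by rewrite (maxP X X' Y' v XP t' vX vY') in nvY.
by have := vsumD b sY; lia.
Qed.

End Descent.

(** This evaluates a partition condition at the chosen subsets [y X] and moves it from integers to
    natural numbers, [p] and [q] being the positive and negative parts. *)
Lemma sum_max_sub_le (V : finType) (P : {set {set V}}) (y : {set V} -> {set V})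
    (h : {set V} -> {set V} -> int) (p q : {set V} -> {set V} -> nat) (c : nat) :
  (forall X Y, h X Y = (p X Y)%:Z - (q X Y)%:Z)%R ->
  (forall X, X \in P -> y X \subset X) ->
  (\sum_(X in P) max_sub X (h X) <= c%:Z)%R ->
  \sum_(X in P) p X (y X) <= c + \sum_(X in P) q X (y X).
Proof.
move=> hE sy le; suff : ((\sum_(X in P) p X (y X))%:Z <= (c + \sum_(X in P) q X (y X))%:Z)%R by [].
rewrite PoszD -lerBlDr !(big_morph Posz PoszD (erefl _)) -sumrB.
by apply: le_trans le; apply: ler_sum => X XP; rewrite -hE (max_sub_geP _ (sy X XP)).
Qed.

(** Two descents are made. The first, with [b] fixed at [f], and the condition on [beta] give m(V)
    at most |E| + beta; the second, with [b] free up to [g], and the condition on [g] give m(V) at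
    most |E| + b(V). The reverse of the latter always holds, so m(V) - b(V) = |E| and b(V) is at
    most beta. *)
Lemma degree_vectors (V : finType) (G : hypergraph V) (S : finType) (loc : S -> V)
    (M : matroid S) (f g : V -> nat) (beta : nat) :
  (forall v, f v <= g v) ->
  (forall P : {set {set V}}, partition P [set: V] ->
     \sum_(X in P) max_sub X (fun Y => (rk M [set: S])%:Z
        - (rk M (located loc Y))%:Z - (vsum g (X :\: Y))%:Z) <= (cross G P)%:Z)%R ->
  (forall P : {set {set V}}, partition P [set: V] ->
     \sum_(X in P) max_sub X (fun Y => (rk M [set: S])%:Z
        - (rk M (located loc Y))%:Z + (vsum f Y)%:Z) <= beta%:Z + (cross G P)%:Z)%R ->
  exists m b : V -> nat,
    [/\ vsum m [set: V] = #|hedge G|, vsum b [set: V] <= beta,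
        forall v, f v <= b v <= g v &
        forall X Y : {set V}, X != set0 -> Y \subset X ->
          rk M [set: S] + induced (@hverts V G) X
            <= vsum m X + vsum b (X :\: Y) + rk M (located loc Y)].
Proof.
move=> le_fg condg condf; pose H := @hverts V G; pose r := rk M [set: S].
(* Every nonempty [X] contains a vertex, whose share r + |E| already makes the slack nonnegative.
   Lower and upper bound for [b] are both [f]. *)
have [] := @descent V _ S H loc M f (fun v => r + #|hedge G| + f v) f.
- move=> X Y /set0Pn[v vX] sY; rewrite /slack.
  have := inducedS H (subsetT X); rewrite inducedT => iX.
  suff : r + #|hedge G| + vsum f Y <= vsum (fun v => r + #|hedge G| + f v) X by lia.
  apply: leq_trans (leq_add (leqnn _) (vsumS f sY)) _.
  rewrite /vsum big_split leq_add2r /= (bigD1 v) //=; exact: leq_addr.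
- by [].
move=> m1 [b1 [ge1 eqb1 _ [P [y [pP sy eqm1]]]]].
have le_m1 : vsum m1 [set: V] <= #|hedge G| + beta.
  have := sum_max_sub_le (p := fun _ Y => rk M [set: S] + vsum f Y)
    (q := fun _ Y => rk M (located loc Y)) (c := beta + cross G P) _ sy (condf P pP).
  move=> /(_ ltac:(by move=> X Y /=; lia)) /=; have := sum_induced_cross G pP.
  have eb : vsum b1 [set: V] = vsum f [set: V].
    by apply: eq_bigr => v _; apply/eqP; rewrite eqn_leq andbC eqb1.
  move: eqm1; rewrite eb -(vsum_partition f pP).
  have <- : \sum_(X in P) (vsum f (y X) + vsum f (X :\: y X)) = \sum_(X in P) vsum f X.
    by apply: eq_bigr => X /sy /vsumD.
  rewrite !big_split /= -/H; lia.
have le_b1g v : b1 v <= g v by case/andP: (eqb1 v) => _ /leq_trans; apply.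
have [m2 [b2 [ge2 bd2 le2 [P2 [y2 [pP2 sy2 eqm2]]]]]] := descent ge1 le_b1g.
have {}bd2 v : f v <= b2 v <= g v.
  by case/andP: (bd2 v) => l2 ->; case/andP: (eqb1 v) => l1 _; rewrite (leq_trans l1 l2).
have up2 : vsum m2 [set: V] <= #|hedge G| + vsum b2 [set: V].
  have := sum_max_sub_le (p := fun _ _ => rk M [set: S])
    (q := fun X Y => rk M (located loc Y) + vsum g (X :\: Y)) _ sy2 (condg P2 pP2).
  move=> /(_ ltac:(by move=> X Y /=; lia)) /=; have := sum_induced_cross G pP2.
  by move: eqm2; rewrite !big_split /= -/H; lia.
(* The pair ({v}, {v}) shows that the truncated subtraction [m2 v - b2 v] is exact. *)
have le_bm v : b2 v <= m2 v.
  have v0 : [set v] != set0 by apply/set0Pn; exists v; rewrite inE.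
  have := ge2 _ _ v0 (subxx _); rewrite /slack !vsum1.
  by have := rk_setT M (located loc [set v]); lia.
have vsumm X : vsum (fun v => m2 v - b2 v) X + vsum b2 X = vsum m2 X.
  by rewrite /vsum -big_split; apply: eq_bigr => v _ /=; rewrite subnK.
(* This is the pair (V, V). It must be nonempty, but without vertices there are no hyperedges
   either. *)
have lo2 : #|hedge G| + vsum b2 [set: V] <= vsum m2 [set: V].
  case: (set_0Vmem [set: V]) => [T0|[v vT]].
    rewrite T0 !vsum0 addn0 leqn0 -(inducedT H) T0 cards_eq0; apply/eqP/setP => e.
    by rewrite !inE subset0 -cards_eq0 gtn_eqF // ltnW // hverts_size.
  have T0 : [set: V] != set0 by apply/set0Pn; exists v.
  have := ge2 _ _ T0 (subxx _); rewrite /slack inducedT.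
  by have := rk_setT M (located loc [set: V]); lia.
exists (fun v => m2 v - b2 v), b2; split=> //.
- by have := vsumm [set: V]; lia.
- by have := vsumm [set: V]; lia.
move=> X Y X0 sY; have := ge2 X Y X0 sY; rewrite /slack.
by have := vsumm X; have := vsumD b2 sY; rewrite -/H; lia.
Qed.

(** * Choosing heads of hyperedges with prescribed degrees *)

Section Heads.

Variables (V E : finType).

Definition set_hedge (H : E -> {set V}) (e : E) (Z : {set V}) : E -> {set V} :=
  fun e' => if e' == e then Z else H e'.

Lemma induced_set_hedge H e Z X :
  induced (set_hedge H e Z) X + (H e \subset X) = induced H X + (Z \subset X).
Proof.
rewrite /induced !card_set_sum (bigD1 e) //= [in RHS](bigD1 e) //= /set_hedge eqxx.
rewrite [X in _ + X + _](eq_bigr (fun e' => nat_of_bool (H e' \subset X))); first lia.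
by move=> e' /negPf ->.
Qed.

(* Hall's theorem, in the form of Hakimi's orientation criterion. *)
Lemma heads_with_degrees (H : E -> {set V}) (m : V -> nat) :
  vsum m [set: V] = #|E| -> (forall X, induced H X <= vsum m X) ->
  exists hd : E -> V, (forall e, hd e \in H e) /\
    forall X : {set V}, #|[set e | hd e \in X]| = vsum m X.
Proof.
(* Sets are shrunk one vertex at a time, keeping the criterion, until all are singletons; the
   induction is on their total size. *)
move=> mT; move: {2}(\sum_e #|H e|) (leqnn (\sum_e #|H e|)) => n.
elim/ltn_ind: n H => n IH H leH indH.
have H0 e : H e != set0.
  apply: contraTneq (indH set0) => He; rewrite vsum0 -ltnNge card_gt0.
  by apply/set0Pn; exists e; rewrite inE He subxx.
case: (boolP [exists e, 1 < #|H e|]) => [/existsP[e He]|/existsPn H1]; last first.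
  (* All sets are singletons here. The head counts of [X] and of its complement are bounded by [m],
     and both totals are |E|, so equality holds. *)
  pose hd (e : E) := xchoose (elimT (set0Pn _) (H0 e)).
  have hdP e : hd e \in H e by apply: (xchooseP (elimT (set0Pn _) (H0 e))).
  have HE e : H e = [set hd e].
    by apply/esym/eqP; rewrite eqEcard sub1set hdP cards1 leqNgt H1.
  have le (X : {set V}) : #|[set e | hd e \in X]| <= vsum m X.
    apply: leq_trans (indH X); apply: subset_leq_card; apply/subsetP => e.
    by rewrite !inE HE sub1set.
  exists hd; split=> // X; have := le X; have := le (~: X).
  have -> : [set e | hd e \in ~: X] = ~: [set e | hd e \in X].
    by apply/setP => e; rewrite !inE.
  have := vsumD m (subsetT X); rewrite setTD mT; have := cardsC [set e | hd e \in X].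
  move=> e1 e2 e3 e4; apply/eqP.
  by rewrite eqn_leq e4 -(leq_add2r (vsum m (~: X))) e2 -e1 leq_add2l.
case/card_gt1P: He => u [v [uH vH nuv]].
(* Deleting [w] from [H e] fails only because of a set [X] with m(X) = i(X) that contains all of
   [H e] but [w]. *)
have shrink w : w \in H e ->
    (forall X : {set V}, induced (set_hedge H e (H e :\ w)) X <= vsum m X) \/
    exists X : {set V}, [/\ ~~ (H e \subset X), H e :\ w \subset X & vsum m X = induced H X].
  move=> wH; case: (boolP [forall X : {set V}, induced (set_hedge H e (H e :\ w)) X <= vsum m X]).
    by move/forallP; left.
  case/forallPn=> X; rewrite -ltnNge => lt; right; exists X; have := indH X.
  have := induced_set_hedge H e (H e :\ w) X; move: lt.
  by case: (H e \subset X); case: (_ :\ w \subset X) => /= *; split=> //; lia.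
have recur w : w \in H e ->
    (forall X : {set V}, induced (set_hedge H e (H e :\ w)) X <= vsum m X) ->
    exists hd : E -> V, (forall e, hd e \in H e) /\
      forall X : {set V}, #|[set e | hd e \in X]| = vsum m X.
  move=> wH le; have [|hd [hdP hdm]] := IH _ _ _ (leqnn _) le.
    apply: leq_trans leH; rewrite [X in X < _](bigD1 e) // [X in _ < X](bigD1 e) //=.
    rewrite /set_hedge eqxx (cardsD1 w (H e)) wH add1n addSn ltnS leq_add2l.
    by rewrite leq_sum // => e' /negPf ->.
  exists hd; split=> // e'; have := hdP e'; rewrite /set_hedge.
  by case: eqP => [-> /setD1P[]|].
have [/(recur u uH) //|[X [nX sX mX]]] := shrink u uH.
have [/(recur v vH) //|[Y [nY sY mY]]] := shrink v vH.
have sU : H e \subset X :|: Y.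
  apply/subsetP => w wH; rewrite inE; case: (eqVneq w u) => [->|wu].
    by rewrite (subsetP sY) ?orbT // !inE nuv.
  by rewrite (subsetP sX) // !inE wu.

(* With [H e] replaced by [K], the counts at [X], [Y] and [X :&: Y] go up by one while that at
   [X :|: Y] does not change. Supermodularity then contradicts the tightness of [X] and [Y]. *)
pose K := (H e :\ u) :\ v.
have KX : K \subset X := subset_trans (subsetDl _ _) sX.
have KY : K \subset Y.
  by apply: subset_trans sY; apply/subsetP => w; rewrite !inE => /and3P[-> _ ->].
have KU : K \subset X :|: Y := subset_trans KX (subsetUl _ _).
have KI : K \subset X :&: Y by rewrite subsetI KX.
have nI : (H e \subset X :&: Y) = false by apply/negP; rewrite subsetI (negPf nX).
have := induced_set_hedge H e K X; have := induced_set_hedge H e K Y.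
have := induced_set_hedge H e K (X :|: Y); have := induced_set_hedge H e K (X :&: Y).
have := induced_supermod (set_hedge H e K) X Y.
rewrite KX KY KU KI sU nI (negPf nX) (negPf nY) /=.
have := indH (X :|: Y); have := indH (X :&: Y); have := vsumUI m X Y.
by move: mX mY; clear; lia.
Qed.

End Heads.

(** * Selecting the elements used as roots *)

Section RootSelection.

Variables (V S : finType) (loc : S -> V) (M : matroid S).
Implicit Types (b f g : V -> nat) (C : {set S}) (X Y : {set V}).

(** Tight pairs with [v] in their second sets meet, hence can be intersected, so one with [#|Y|]
    smallest has the least [Y]. *)
Lemma tight_min (h : {set V} -> {set V} -> int) v X0 Y0 :
  intersecting_submodular h -> nested_nonneg h -> tight h X0 Y0 -> v \in Y0 ->
  exists X Y : {set V}, [/\ tight h X Y, v \in Y &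
    forall X' Y' : {set V}, tight h X' Y' -> v \in Y' -> Y \subset Y'].
Proof.
move=> subm ge0 t0 v0; pose p (Z : {set V} * {set V}) := (v \in Z.2) && tight h Z.1 Z.2.
have p0 : p (X0, Y0) by rewrite /p /= v0.
case: (@arg_minnP _ (X0, Y0) p (fun Z => #|Z.2|) p0) => -[X Y] /andP[/= vY tXY] minY.
exists X, Y; split=> // X' Y' t' vY'.
have I0 : X :&: X' != set0.
  apply/set0Pn; exists v; case/and3P: tXY => _ /subsetP/(_ v vY) vX _.
  by case/and3P: t' => _ /subsetP/(_ v vY') vX' _; rewrite inE vX.
have /andP[_ tI] := tight_uncross subm ge0 I0 tXY t'.
have := minY (X :&: X', Y :&: Y'); rewrite /p /= inE vY vY' tI => /(_ isT) le.
by apply/setIidPl/eqP; rewrite eqEcard subsetIl le.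
Qed.

(** Minimality of [C] makes each of its elements at [v] a coloop in some tight pair. In the least
    tight [Y] containing [v] they are all coloops together, which gives independence, and dropping
    [v] from [Y] bounds their number. *)
Lemma root_selection (rho : {set V} -> nat) b :
  (forall X Y, X :&: Y != set0 -> rho (X :|: Y) + rho (X :&: Y) <= rho X + rho Y) ->
  (forall X Y, X != set0 -> Y \subset X ->
     rk M [set: S] <= rho X + vsum b (X :\: Y) + rk M (located loc Y)) ->
  exists C, (forall v, indep M (C :&: located loc [set v]) /\
                       #|C :&: located loc [set v]| <= b v) /\
    forall X, X != set0 -> rk M [set: S] <= rho X + rk M (C :&: located loc X).
Proof.
move=> rho_sub feasT.
pose feas C := [forall X : {set V}, forall Y : {set V}, (X != set0) && (Y \subset X) ==>
  (rk M [set: S] <= rho X + vsum b (X :\: Y) + rk M (C :&: located loc Y))].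
have feasP C : reflect (forall X Y : {set V}, X != set0 -> Y \subset X ->
    rk M [set: S] <= rho X + vsum b (X :\: Y) + rk M (C :&: located loc Y)) (feas C).
  apply: (iffP forallP) => [H X Y X0 sY|H X].
    by have /forallP/(_ Y)/implyP := H X; apply; rewrite X0.
  by apply/forallP => Y; apply/implyP => /andP[]; apply: H.
have [|C minC _] := @minset_exists _ feas [set: S].
  by apply/feasP => X Y; rewrite setTI; apply: feasT.
have /feasP feasC := minsetp minC.
pose h (X Y : {set V}) := ((rho X + vsum b (X :\: Y) + rk M (C :&: located loc Y))%:Z
                - (rk M [set: S])%:Z)%R.
have h_ge0 : nested_nonneg h by move=> X Y X0 sY; rewrite /h; have := feasC X Y X0 sY; lia.
have h_sub : intersecting_submodular h.
  move=> X1 Y1 X2 Y2 I0 s1 s2; rewrite /h.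
  have := vsumD b s1; have := vsumD b s2.
  have := vsumD b (setUSS s1 s2); have := vsumD b (setISS s1 s2).
  have := vsumUI b X1 X2; have := vsumUI b Y1 Y2; have := rho_sub X1 X2 I0.
  have := rk_submod M (C :&: located loc Y1) (C :&: located loc Y2).
  by rewrite -setIUr -setIIr -locatedU -locatedI; lia.
pose D (Y : {set V}) := C :&: located loc Y.
have blocked s : s \in C ->
    exists X Y : {set V}, [/\ tight h X Y, loc s \in Y & rk M (D Y :\ s) < rk M (D Y)].
  move=> sC; have : ~~ feas (C :\ s).
    apply/negP => fe; have := minsetinf minC fe (subsetDl _ _).
    by move/setP/(_ s); rewrite !inE eqxx sC.
  case/forallPn=> X /forallPn[Y]; rewrite negb_imply -ltnNge => /andP[/andP[X0 sY] lt].
  have DE : (C :\ s) :&: located loc Y = D Y :\ s by apply/setP => x; rewrite !inE andbA.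
  have le := feasC X Y X0 sY; rewrite DE in lt.
  have lt1 : rk M (D Y :\ s) < rk M (D Y) by rewrite -/(D Y) in le; lia.
  (* Removing [s] costs at most one in rank, so an inequality violated by [C :\ s] is tight for
     [C]. *)
  have rk1 : rk M (D Y) <= (rk M (D Y :\ s)).+1.
    have := rk_setU M [set s] (D Y :\ s); have := rk_card M [set s]; rewrite cards1.
    have : rk M (D Y) <= rk M ([set s] :|: D Y :\ s).
      by apply: rk_mono; apply/subsetP => x; rewrite !inE; case: (x == s).
    lia.
  have sD : s \in D Y.
    apply: contraLR lt1 => nsD; rewrite -leqNgt; apply/rk_mono/subsetP => x xD.
    rewrite in_setD1 xD andbT; apply: contraNneq nsD => <-; exact: xD.
  exists X, Y; split=> //; last by move: sD; rewrite !inE => /andP[].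
  by rewrite /tight X0 sY /h -/(D Y); apply/eqP; rewrite -/(D Y) in le; lia.
exists C; split=> [v|X X0]; last by have := feasC X X X0 (subxx _); rewrite setDv vsum0 addn0.
rewrite -/(D [set v]); have DvE s : (s \in D [set v]) = (s \in C) && (loc s == v).
  by rewrite !inE.
case: (set_0Vmem (D [set v])) => [->|[s0]].
  by rewrite /indep rk_set0 cards0 eqxx.
rewrite DvE => /andP[/blocked[X0 [Y0 [t0 v0 _]]] /eqP l0]; rewrite l0 in v0.
have [X [Y [tXY vY minY]]] := tight_min h_sub h_ge0 t0 v0.
have sv : D [set v] \subset D Y.
  by apply: setIS; apply: located_sub; rewrite sub1set.
have coloop s : s \in D [set v] -> rk M (D Y :\ s) < rk M (D Y).
  move=> sDv; move: (sDv); rewrite DvE => /andP[sC /eqP ls].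
  have [X' [Y' [t' v' lt']]] := blocked s sC; rewrite ls in v'.
  have sYY' : D Y \subset D Y' := setIS C (located_sub loc (minY X' Y' t' v')).
  have sDY := subsetP sv s sDv; have sDY' := subsetP sYY' s sDY.
  rewrite ltnNge; apply: contraL lt' => le; rewrite -leqNgt.
  have := @rk_closure_mono _ M s _ _ (setSD [set s] sYY').
  by rewrite !setD1K //; apply.
have := rk_coloops sv coloop.
have DU : rk M (D Y) <= rk M (D Y :\: D [set v]) + rk M (D [set v]).
  apply: leq_trans (rk_setU M _ _); apply: rk_mono.
  by apply/subsetP => s sD; rewrite in_setU in_setD sD andbT orNb.
have cD := rk_card M (D [set v]).
move=> le; split; first by apply/eqP; lia.
(* The tight pair (X, Y) is compared with (X, Y - v): b grows by [b v] and the rank loses at least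
   the number of elements of [C] at [v]. *)
have /and3P[X1 sY /eqP] := tXY; rewrite /h -/(D Y) => tt.
have sY1 : Y :\ v \subset X := subset_trans (subsetDl _ _) sY.
have := feasC X (Y :\ v) X1 sY1.
have -> : C :&: located loc (Y :\ v) = D Y :\: D [set v].
  apply/setP => s; rewrite !inE; by case: (s \in C); rewrite ?andbF.
have := vsumD b sY; have := vsumD b sY1.
have s1Y : [set v] \subset Y by rewrite sub1set.
have := vsumD b s1Y; rewrite vsum1.
by move: le DU cD tt; clear; lia.
Qed.

Lemma rk_augment_at (B : {set S}) v :
  indep M (B :&: located loc [set v]) ->
  #|B :&: located loc [set v]| < rk M (located loc [set v]) ->
  exists s, [/\ s \notin B, loc s = v & indep M ((s |: B) :&: located loc [set v])].
Proof.
move=> iB; rewrite -(eqP iB) => /rk_augment[s]; rewrite !inE => /eqP ls lt.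
exists s; split=> //; last first.
  have -> : (s |: B) :&: located loc [set v] = s |: (B :&: located loc [set v]).
    by apply/setP => x; rewrite !inE; case: eqP => // ->; rewrite ls eqxx.
  exact: indepU1.
apply: contraTN lt => sB; rewrite -leqNgt.
by rewrite (setUidPr _) // sub1set !inE sB ls eqxx.
Qed.

Lemma card_at_sum (B : {set S}) : #|B| = \sum_v #|B :&: located loc [set v]|.
Proof.
rewrite -sum1_card (partition_big loc predT) //=; apply: eq_bigr => v _.
by rewrite -sum1_card; apply: eq_bigl => s; rewrite !inE.
Qed.

(** While the size is below the total of [u], some vertex has room, and since [u v] is at most the
    rank at [v] an independent element can be added there. *)
Lemma enlarge_roots (C : {set S}) (u : V -> nat) (n : nat) :
  (forall v, indep M (C :&: located loc [set v])) ->
  (forall v, #|C :&: located loc [set v]| <= u v) ->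
  (forall v, u v <= rk M (located loc [set v])) ->
  #|C| <= n <= \sum_v u v ->
  exists B : {set S}, [/\ C \subset B, #|B| = n,
    forall v, indep M (B :&: located loc [set v]) &
    forall v, #|B :&: located loc [set v]| <= u v].
Proof.
move=> iC Cu ur /andP[Cn nu].
elim: n Cn nu => [|n IH] Cn nu.
  by exists C; split=> //; apply/eqP; rewrite -leqn0.
case: (eqVneq #|C| n.+1) => [e|ne]; first by exists C.
have [||B [sCB cB iB Bu]] := IH; [by rewrite -ltnS ltn_neqAle ne | exact: ltnW |].
have /existsP[v lt] : [exists v, #|B :&: located loc [set v]| < u v].
  rewrite -[X in is_true X]negbK negb_exists; apply/negP => /forallP ge.
  move: nu; rewrite -cB (card_at_sum B) ltnNge => /negP; apply.
  by apply: leq_sum => v _; rewrite leqNgt ge.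
have [s [nB ls iv]] := rk_augment_at (iB v) (leq_trans lt (ur v)).
have other w : w != v -> (s |: B) :&: located loc [set w] = B :&: located loc [set w].
  move=> wv; apply/setP => x; rewrite !inE; case: (eqVneq x s) => // ->.
  by rewrite ls eq_sym (negPf wv) !andbF.
exists (s |: B); split.
- exact: subset_trans sCB (subsetUr _ _).
- by rewrite cardsU1 nB cB.
- by move=> w; case: (eqVneq w v) => [->|/other ->].
move=> w; case: (eqVneq w v) => [->|/other -> //].
have -> : (s |: B) :&: located loc [set v] = s |: (B :&: located loc [set v]).
  by apply/setP => x; rewrite !inE; case: eqP => // ->; rewrite ls eqxx.
by apply: leq_trans lt; rewrite cardsU1; case: (_ \notin _) => /=; lia.
Qed.

End RootSelection.

(** * One growth step in a directed hypergraph *)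

Section Growth.

Variables (V E S : finType) (H : E -> {set V}) (hd : E -> V) (M : matroid S).
Hypothesis hdH : forall e, hd e \in H e.
Implicit Types (A : {set E}) (R : V -> {set S}) (X Y Z : {set V}) (e : E) (s : S) (u v : V).

(** The in-degree of [X] among the hyperedges of [A], each directed towards its head. *)
Definition entering A X : nat := #|[set e in A | (hd e \in X) && ~~ (H e \subset X)]|.

Lemma entering_submod A X Y :
  entering A (X :|: Y) + entering A (X :&: Y) <= entering A X + entering A Y.
Proof.
rewrite /entering !card_set_sum -!big_split; apply: leq_sum => e _ /=.
case: (e \in A) => //=; rewrite !inE subsetI.
have := fun h : H e \subset X => subset_trans h (subsetUl X Y).
have := fun h : H e \subset Y => subset_trans h (subsetUr X Y).
case: (H e \subset X); case: (H e \subset Y); case: (H e \subset X :|: Y);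
  case: (hd e \in X); case: (hd e \in Y) => //= h1 h2;
  by [have := h1 isT | have := h2 isT].
Qed.

Lemma entering_induced X : entering [set: E] X + induced H X = #|[set e | hd e \in X]|.
Proof.
rewrite /entering /induced !card_set_sum -big_split; apply: eq_bigr => e _ /=.
rewrite inE /=; case: (boolP (H e \subset X)) => [/subsetP s|_]; last by rewrite andbT addn0.
by rewrite (s _ (hdH e)).
Qed.

Lemma entering_setD1 A X e : e \in A ->
  entering (A :\ e) X + ((hd e \in X) && ~~ (H e \subset X)) = entering A X.
Proof.
move=> eA; rewrite /entering !card_set_sum (bigD1 e) //= [in RHS](bigD1 e) //=.
rewrite !inE eqxx eA /= addnC; congr (_ + _); apply: eq_bigr => e' ne.
by rewrite !inE ne.
Qed.

(** When [R v] holds the roots of the trees through [v], these are the roots of the trees meeting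
    [X]. *)
Definition elements R X : {set S} := \bigcup_(v in X) R v.

Lemma elementsS R X Y : X \subset Y -> elements R X \subset elements R Y.
Proof.
by move/subsetP => sXY; apply/bigcupsP => v /sXY vY; exact: bigcup_sup.
Qed.

Lemma elementsU R X Y : elements R (X :|: Y) = elements R X :|: elements R Y.
Proof. exact: bigcup_setU. Qed.

Definition add_element R v s : V -> {set S} := fun w => if w == v then s |: R w else R w.

Lemma elements_sub_add R v s X : elements R X \subset elements (add_element R v s) X.
Proof.
apply/bigcupsP => w wX; apply: (subset_trans _ (bigcup_sup w wX)).
by rewrite /add_element; case: (w == v); rewrite ?subsetUr.
Qed.

Lemma elements_add R v s X : v \in X -> s |: elements R X \subset elements (add_element R v s) X.
Proof.
move=> vX; rewrite subUset elements_sub_add andbT sub1set.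
by apply/bigcupP; exists v; rewrite // /add_element eqxx setU11.
Qed.

Local Notation r := (rk M [set: S]).

(* The edge e is looked for inside an inclusion-minimal tight set X on which
   some vertex has smaller rank than X: a tight set forbidding e would intersect
   X in a smaller such set. *)
Lemma growth_step A R v0 :
  (forall X, X != set0 -> r <= rk M (elements R X) + entering A X) -> rk M (R v0) < r ->
  exists e u s, [/\ e \in A, u \in H e, s \in R u,
    rk M (R (hd e)) < rk M (s |: R (hd e)) &
    forall X, X != set0 ->
      r <= rk M (elements (add_element R (hd e) s) X) + entering (A :\ e) X].
Proof.
move=> inv lt0.
pose p X := [&& X != set0, rk M (elements R X) + entering A X == r &
                [exists v in X, rk M (R v) < rk M (elements R X)]].
have nonempty v X : v \in X -> X != set0 by move=> vX; apply/set0Pn; exists v.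
have entT : entering A [set: V] = 0.
  by apply/eqP; rewrite cards_eq0; apply/eqP/setP => e; rewrite !inE subsetT !andbF.
have rT : rk M (elements R [set: V]) = r.
  apply/anti_leq; rewrite rk_setT /=.
  by have := inv _ (nonempty v0 _ (in_setT v0)); rewrite entT addn0.
have pT : p [set: V].
  rewrite /p (nonempty v0) ?inE // entT rT addn0 eqxx /=.
  by apply/exists_inP; exists v0.
have [X minX _] := minset_exists pT.
have /and3P[X0 /eqP tX /exists_inP[v vX ltv]] := minsetp minX.
(* These are the vertices of [X] whose elements lie in the closure of [R v]. The rank of [Y] is
   below that of [X], so more hyperedges enter [Y] than [X]; one that enters only [Y] lies inside
   [X] and has an end [u] outside [Y]. *)
pose Y := [set w in X | rk M (R v :|: R w) <= rk M (R v)].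
have vY : v \in Y by rewrite inE vX setUid /=.
have rY : rk M (elements R Y) <= rk M (R v).
  apply: leq_trans (rk_mono M (subsetUr (R v) _)) _; apply: rk_closureU => s.
  case/bigcupP => w; rewrite inE => /andP[_ le] sw; apply: leq_trans le.
  by apply: rk_mono; rewrite setUC; apply: setUS; rewrite sub1set.
have : entering A X < entering A Y by have := inv Y (nonempty v Y vY); lia.
have [e eY neX] : exists2 e, e \in [set e in A | (hd e \in Y) && ~~ (H e \subset Y)] &
    e \notin [set e in A | (hd e \in X) && ~~ (H e \subset X)].
  apply/subsetPn; apply/negP => /subset_leq_card; rewrite -/(entering A X) -/(entering A Y).
  by have := inv Y (nonempty v Y vY); lia.
move=> _; move: eY neX; rewrite !inE => /andP[eA /andP[/andP[hX hspan] neY]].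
rewrite eA hX /= negbK => eX.
have /subsetPn[u uH nuY] := neY.
have uX := subsetP eX u uH; move: nuY; rewrite inE uX /= -ltnNge => /rk_augment[s].
rewrite inE => /orP[sv|su] lts.
  by rewrite (setUidPr _) ?sub1set // ltnn in lts.
(* The head of [e] is in [Y], so [R (hd e)] lies in the closure of [R v], which does not contain
   [s]. *)
have lth : rk M (R (hd e)) < rk M (s |: R (hd e)).
  rewrite ltnNge; apply/negP => le.
  have := rk_closure_mono (subsetUr (R v) (R (hd e))) le.
  have : rk M (s |: R v) <= rk M (s |: (R v :|: R (hd e))).
    by apply: rk_mono; apply/setUS/subsetUl.
  by move=> h1 h2; have := leq_trans h1 (leq_trans h2 hspan); rewrite leqNgt lts.
(* A set [Z] violating the new inequality is tight, is entered by [e] and has [s] in the closure of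
   its elements. *)
exists e, u, s; split=> // Z Z0; rewrite leqNgt; apply/negP => ltZ.
have invZ := inv Z Z0; have := entering_setD1 Z eA.
have := rk_mono M (elements_sub_add R (hd e) s Z).
case: (boolP (hd e \in Z)) => [hZ|_] /=; last by move: ltZ invZ; clear; lia.
case: (boolP (H e \subset Z)) => [_|nZ] /=; first by move: ltZ invZ; clear; lia.
move=> _ eZ; have := rk_mono M (elements_add R s hZ) => leZ.
have leZ' := rk_mono M (subsetUr [set s] (elements R Z)).
have tZ : rk M (elements R Z) + entering A Z = r.
  by move: eZ ltZ invZ leZ leZ'; clear; lia.
have sZ : rk M (s |: elements R Z) <= rk M (elements R Z).
  by move: eZ ltZ invZ leZ tZ; clear; lia.
have hI : hd e \in X :&: Z by rewrite inE hX.
have I0 := nonempty _ _ hI.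
have U0 : X :|: Z != set0 by apply: (nonempty (hd e)); rewrite inE hX.
have invI := inv _ I0; have invU := inv _ U0; have esub := entering_submod A X Z.
have sX : s \in elements R X by apply/bigcupP; exists u.
have subI : elements R (X :&: Z) \subset elements R X :&: elements R Z.
  by rewrite subsetI !elementsS ?subsetIl ?subsetIr.
have rsub := rk_submod M (elements R X) (elements R Z); rewrite -elementsU in rsub.
have rI := rk_mono M subI.
have rssub := rk_submod M (elements R X) (s |: elements R Z).
have rsI : rk M (s |: elements R (X :&: Z)) <= rk M (elements R X :&: (s |: elements R Z)).
  apply: rk_mono; rewrite subUset sub1set inE sX setU11 /=.
  by apply: subset_trans subI _; apply/setIS/subsetUr.
have rsU : rk M (elements R (X :|: Z)) <= rk M (elements R X :|: (s |: elements R Z)).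
  by apply: rk_mono; rewrite elementsU; apply/setUS/subsetUr.
(* Uncrossing makes [X :&: Z] tight. If [R (hd e)] had its full rank, [s] would raise that rank, and
   submodularity with [s |: elements R Z] would gain one too much. *)
have pI : p (X :&: Z).
  rewrite /p I0 /=; apply/andP; split.
    by apply/eqP; move: tX tZ invI invU esub rsub rI; clear; lia.
  apply/exists_inP; exists (hd e) => //; rewrite ltnNge; apply/negP => le.
  have sh : R (hd e) \subset elements R (X :&: Z) by apply: bigcup_sup hI.
  have : rk M (s |: R (hd e)) <= rk M (s |: elements R (X :&: Z)) by apply/rk_mono/setUS.
  by move: le lth invU tX tZ invI esub rsub rI rssub rsI rsU sZ; clear; lia.
have := minsetinf minX pI (subsetIl _ _) => XI.
by move/negP: nZ; apply; apply: subset_trans eX _; rewrite -XI subsetIr.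
Qed.

End Growth.

(** * Adding a leaf to a rooted tree *)

Section Trees.

Variables (V E : finType).
Implicit Types (t : E -> {set V}) (F : {set E}) (e : E) (u v x : V).

Lemma eq_tverts t t' x F : {in F, t =1 t'} -> tverts t (x, F) = tverts t' (x, F).
Proof. by move=> eqt; rewrite /tverts /=; congr (_ |: _); apply: eq_bigr => e /eqt. Qed.

Lemma eq_rooted_tree t t' x F :
  {in F, t =1 t'} -> rooted_tree t (x, F) -> rooted_tree t' (x, F).
Proof.
move=> eqt [con acy]; split=> [y|c c0 u1 u2 cF].
  rewrite -(eq_tverts x eqt) => /con; congr is_true; apply: eq_connect => a b /=.
  by apply: eq_existsb => e; case: (boolP (e \in F)) => //= eF; rewrite /joins eqt.
apply: contra (acy c c0 u1 u2 cF); rewrite (@eq_in_cycle _ (fun q => q.2 \in F)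
  (fun p q => joins t p.2 p.1 q.1) (fun p q => joins t' p.2 p.1 q.1)) //.
  by move=> a b aF _; rewrite /joins eqt.
by rewrite -all_map.
Qed.

(** A cycle through [v] would need two distinct edges at [v], where only [e] is available; a cycle
    using [e] would pass through [v]. So every cycle already lies in [F]. *)
Lemma acyclic_leaf t F e u v :
  u != v -> t e = [set u; v] -> (forall f, f \in F -> v \notin t f) ->
  acyclic t F -> acyclic t (e |: F).
Proof.
move=> uv te nv acy c c0 u1 u2 cF; apply/negP => cyc.
have only f : f \in e |: F -> v \in t f -> f = e.
  by rewrite !inE => /orP[/eqP //|/nv /negPf ->].
have cF' i q : q \in rot i c -> q.2 \in e |: F.
  by rewrite mem_rot => qc; apply: (allP cF); apply: map_f.
have nvc : v \notin unzip1 c.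
  apply/negP => /mapP[[x f] /rot_to[i c' rc] /= vx]; rewrite -{x}vx in rc.
  have fF : f \in e |: F by apply: (cF' i (v, f)); rewrite rc mem_head.
  have : uniq (unzip2 (rot i c)) by rewrite /unzip2 map_rot rot_uniq.
  (* With the cycle rotated to start at [v], either it has one edge, a loop, or its first and last
     edges both meet [v] and so both equal [e]. *)
  move: cyc; rewrite -(rot_cycle i) rc; case/lastP: c' rc => [|c' [y g]] rc /=.
    rewrite andbT => /eqP tf _; have fe : f = e by apply: only; rewrite // tf set21.
    by have := cards2 u v; rewrite -te -fe tf cards2 eqxx uv.
  rewrite rcons_path => /andP[pc]; rewrite last_rcons => /eqP tg /andP[nfg _].
  have gF : g \in e |: F by apply: (cF' i (y, g)); rewrite rc inE mem_rcons mem_head orbT.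
  have ge : g = e by apply: only; rewrite // tg set22.
  have fe : f = e.
    apply: only => //; move: pc; case: (c') => [|q c''] /=; rewrite ?andbT.
      by move=> /eqP ->; rewrite set21.
    by move=> /andP[/eqP -> _]; rewrite set21.
  by move: nfg; rewrite /unzip2 map_rcons mem_rcons /= ge fe mem_head.
have nec : e \notin unzip2 c.
  apply/negP => /mapP[[x f] /rot_to[i c' rc] /= fe]; rewrite -{f}fe in rc.
  have sub q : q \in rot i c -> q.1 != v.
    by rewrite mem_rot => qc; apply: contraNneq nvc => <-; apply: map_f.
  have [q qc te'] : exists2 q, q \in rot i c & t e = [set x; q.1].
    move: cyc; rewrite -(rot_cycle i) rc; case: c' {rc} => [|q c'] /=.
      by rewrite andbT => /eqP te'; exists (x, e); rewrite ?inE ?eqxx.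
    by case/andP => /eqP te' _; exists q; rewrite // !inE eqxx orbT.
  have : v \in t e by rewrite te set22.
  have xv : x != v by apply: (sub (x, e)); rewrite rc mem_head.
  by rewrite te' !inE eq_sym (negPf xv) eq_sym (negPf (sub q qc)).
apply/negP: cyc; apply: acy => //; apply/allP => f fc.
have := allP cF f fc; rewrite !inE => /orP[/eqP fe|//].
by rewrite -fe fc in nec.
Qed.

(** The trimming may change outside [F], because a hyperedge receives its final ends only when it is
    used. *)
Lemma rooted_tree_leaf t t' x F e u v :
  {in F, t =1 t'} -> rooted_tree t (x, F) -> e \notin F -> t' e = [set u; v] ->
  u \in tverts t (x, F) -> v \notin tverts t (x, F) ->
  rooted_tree t' (x, e |: F) /\ tverts t' (x, e |: F) = v |: tverts t (x, F).
Proof.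
move=> eqt tree neF te uT vT.
have [con acy] := eq_rooted_tree eqt tree; rewrite (eq_tverts x eqt) in uT vT *.
have tvE : tverts t' (x, e |: F) = v |: tverts t' (x, F).
  apply/setP => y; move: uT; rewrite /tverts /= bigcup_setU big_set1 te !inE => uT.
  case: (y == v); rewrite ?orbT //= orbF.
  by case: (eqVneq y u) => [->|_] //=; rewrite orbT uT.
have con_sub : subrel (connect (adj t' F)) (connect (adj t' (e |: F))).
  apply: connect_sub => a b /exists_inP[f fF ab]; apply: connect1.
  by apply/exists_inP; exists f; rewrite // inE fF orbT.
split=> //; split=> [y|].
  rewrite tvE inE in_set1 => /orP[/eqP ->|/con/con_sub //].
  apply: connect_trans (con_sub _ _ (con u uT)) _; apply: connect1.
  by apply/exists_inP; exists e; rewrite ?setU11 // /joins te.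
apply: acyclic_leaf te _ acy; first by apply: contraNneq vT => <-.
move=> f fF; apply: contra vT => vf; rewrite /tverts /= inE.
by apply/orP; right; apply/bigcupP; exists f.
Qed.

End Trees.

Lemma disjoint_setU1 (T : finType) (x : T) (A B : {set T}) :
  [disjoint x |: A & B] = (x \notin B) && [disjoint A & B].
Proof. by rewrite !disjoints_subset subUset sub1set inE. Qed.

(** * Growing all trees to a based packing *)

Section Forests.

Variables (V E S : finType) (H : E -> {set V}) (hd : E -> V) (M : matroid S) (loc : S -> V).
Hypothesis hdH : forall e, hd e \in H e.

Local Notation r := (rk M [set: S]).

(* R v is the set of roots whose current tree contains v, and A the set of
   hyperedges not used yet. *)
Lemma forest_growth (B : {set S}) n (A : {set E}) (R : V -> {set S})
    (t : E -> {set V}) (F : S -> {set E}) :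
  #|A| <= n -> (forall v, indep M (R v)) ->
  (forall X : {set V}, X != set0 -> r <= rk M (elements R X) + entering H hd A X) ->
  (forall e, t e \subset H e /\ #|t e| = 2) ->
  (forall s, rooted_tree t (loc s, F s)) ->
  (forall v s, (s \in R v) = (s \in B) && (v \in tverts t (loc s, F s))) ->
  (forall s s', s != s' -> [disjoint F s & F s']) ->
  (forall s, [disjoint F s & A]) ->
  exists (t : E -> {set V}) (F : S -> {set E}),
    [/\ forall e, t e \subset H e /\ #|t e| = 2,
        forall s, rooted_tree t (loc s, F s),
        forall s s', s != s' -> [disjoint F s & F s'] &
        forall v, basis M [set s in B | v \in tverts t (loc s, F s)]].
Proof.
elim: n A R t F => [|n IH] A R t F leA iR inv trim trees RE disF disA;
  case: (boolP [forall v, r <= rk M (R v)]) => [/forallP full|/forallPn[v0]].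
- exists t, F; split=> // v; have -> : [set s in B | v \in tverts t (loc s, F s)] = R v.
    by apply/setP => s; rewrite inE RE.
  by apply/basisP; split=> //; apply/anti_leq; rewrite rk_setT full.
- rewrite -ltnNge => /(growth_step inv)[e [u [s [eA _ _ _ _]]]].
  by move: leA; rewrite leqn0 cards_eq0 => /eqP A0; rewrite A0 inE in eA.
- exists t, F; split=> // v; have -> : [set s in B | v \in tverts t (loc s, F s)] = R v.
    by apply/setP => s; rewrite inE RE.
  by apply/basisP; split=> //; apply/anti_leq; rewrite rk_setT full.
rewrite -ltnNge => /(growth_step inv)[e [u [s [eA uH su lts inv']]]].
pose v := hd e; pose t' := set_hedge t e [set u; v].
pose F' := fun s' => if s' == s then e |: F s else F s'.
have nFe s' : e \notin F s'.
  by apply/negP => eF; have /pred0P/(_ e) := disA s'; rewrite /= eF eA.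
have nsv : s \notin R v.
  by apply: contraTN lts => sv; rewrite (setUidPr _) ?ltnn // sub1set.
have eqt s' : {in F s', t =1 t'}.
  by move=> f fF; rewrite /t' /set_hedge; case: eqP => // fe; have := nFe s'; rewrite -fe fF.
have te : t' e = [set u; v] by rewrite /t' /set_hedge eqxx.
have [sB uT] : s \in B /\ u \in tverts t (loc s, F s) by apply/andP; rewrite -RE.
have vT : v \notin tverts t (loc s, F s) by move: nsv; rewrite RE sB.
have uv : u != v by apply: contraNneq vT => <-.
have [treeL tvL] := rooted_tree_leaf (eqt s) (trees s) (nFe s) te uT vT.
apply: (IH (A :\ e) (add_element R v s) t' F').
- by move: leA; rewrite (cardsD1 e) eA.
- move=> w; rewrite /add_element; case: eqP => [->|_] //.
  exact: indepU1.
- exact: inv'.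
- move=> f; rewrite /t' /set_hedge; case: eqP => [->|_]; last exact: trim.
  by rewrite cards2 uv subUset !sub1set uH hdH.
- move=> s'; rewrite /F'; case: eqP => [->|_] //; exact: eq_rooted_tree (trees s').
- move=> w s'; rewrite /F' /add_element; case: (eqVneq s' s) => [->|ne].
    rewrite tvL in_setU1 sB /=; case: (eqVneq w v) => [_|_]; first by rewrite setU11.
    by rewrite RE sB.
  rewrite -(eq_tverts (loc s') (@eqt s')) -RE.
  by case: (w == v) => //; rewrite in_setU1 (negPf ne).
- move=> s1 s2 ne; rewrite /F'.
  case: (eqVneq s1 s) => [e1|_]; case: (eqVneq s2 s) => [e2|_]; last exact: disF.
  + by rewrite e1 e2 eqxx in ne.
  + by rewrite disjoint_setU1 nFe disF // -e1.
  by rewrite disjoint_sym disjoint_setU1 nFe disF // -e2 eq_sym.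
move=> s'; rewrite /F'; case: eqP => [_|_].
  rewrite disjoint_setU1 !inE eqxx /=.
  exact: disjointWr (subsetDl _ _) (disA s).
exact: disjointWr (subsetDl _ _) (disA s').
Qed.

Lemma directed_packing (B : {set S}) :
  (forall e, 1 < #|H e|) ->
  (forall v, indep M (B :&: located loc [set v])) ->
  (forall X : {set V}, X != set0 ->
     r <= entering H hd [set: E] X + rk M (B :&: located loc X)) ->
  exists (t : E -> {set V}) (F : S -> {set E}),
    [/\ forall e, t e \subset H e /\ #|t e| = 2,
        forall s, rooted_tree t (loc s, F s),
        forall s s', s != s' -> [disjoint F s & F s'] &
        forall v, basis M [set s in B | v \in tverts t (loc s, F s)]].
Proof.
move=> H2 iB inv.
have exZ e : exists Z : {set V}, (Z \subset H e) && (#|Z| == 2).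
  have /card_gt1P[x [y [xH yH xy]]] := H2 e.
  by exists [set x; y]; rewrite subUset !sub1set xH yH cards2 xy.
have tvE t s : tverts t (loc s, set0 : {set E}) = [set loc s].
  by rewrite /tverts /= big_set0 setU0.
apply: (@forest_growth B #|E| [set: E] (fun v => B :&: located loc [set v])
          (fun e => xchoose (exZ e)) (fun _ => set0)).
- by rewrite cardsT.
- exact: iB.
- move=> X X0; rewrite addnC; apply: leq_trans (inv X X0) _.
  rewrite leq_add2l; apply: rk_mono; apply/subsetP => s; rewrite !inE => /andP[sB sX].
  by apply/bigcupP; exists (loc s); rewrite // !inE sB eqxx.
- by move=> e; have /andP[? /eqP ?] := xchooseP (exZ e).
- move=> s; split=> [y|c c0 _ _].
    by rewrite tvE inE => /eqP ->; apply: connect0.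
  by case: c c0 => //= -[x e] c _; rewrite inE.
- by move=> v s; rewrite tvE !inE eq_sym.
- by move=> s s' _; rewrite -setI_eq0 set0I.
by move=> s; rewrite -setI_eq0 set0I.
Qed.

End Forests.

(** * Sufficiency: assembling the packing *)

Lemma sufficiency (V : finType) (G : hypergraph V) (S : finType) (loc : S -> V)
    (M : matroid S) (f g : V -> nat) (alpha beta : nat) :
  (forall v, f v <= minn (rk M (located loc [set v])) (g v)) ->
  alpha <= beta ->
  alpha <= \sum_v minn (rk M (located loc [set v])) (g v) ->
  (forall P : {set {set V}}, partition P [set: V] ->
     \sum_(X in P) max_sub X (fun Y => (rk M [set: S])%:Z
        - (rk M (located loc Y))%:Z - (vsum g (X :\: Y))%:Z) <= (cross G P)%:Z)%R ->
  (forall P : {set {set V}}, partition P [set: V] ->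
     \sum_(X in P) max_sub X (fun Y => (rk M [set: S])%:Z
        - (rk M (located loc Y))%:Z + (vsum f Y)%:Z) <= beta%:Z + (cross G P)%:Z)%R ->
  exists (k : nat) (P : 'I_k -> V * {set hedge G}),
    based_bounded_limited_hypertree_packing loc M f g alpha beta P.
Proof.
move=> f_le le_ab le_a condg condf.
have f_g v : f v <= g v by have := f_le v; rewrite leq_min => /andP[].
have f_r v : f v <= rk M (located loc [set v]) by have := f_le v; rewrite leq_min => /andP[].
have [m [b [mT bT bfg mb]]] := degree_vectors f_g condg condf.
have [|hd [hdH hdm]] := heads_with_degrees (H := @hverts V G) mT.
  move=> X; case: (eqVneq X set0) => [->|X0].
    rewrite vsum0 leqn0 cards_eq0; apply/eqP/setP => e.
    by rewrite !inE subset0 -cards_eq0 gtn_eqF // ltnW // hverts_size.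
  have := mb X X X0 (subxx _); rewrite setDv vsum0 addn0.
  by have := rk_setT M (located loc X); lia.
pose rho := entering (@hverts V G) hd [set: hedge G].
have [||C [Cv Crk]] := @root_selection V S loc M rho b.
- by move=> X Y _; apply: entering_submod.
- move=> X Y X0 sY; have := mb X Y X0 sY; rewrite -hdm -(entering_induced hdH) -/rho.
  by clear; lia.
have iC v := (Cv v).1; have Cb v := (Cv v).2.
(* The first enlargement reaches [f v] roots at each vertex; staying below [b] keeps the total at
   most [beta]. *)
pose u1 v := maxn (f v) #|C :&: located loc [set v]|.
have CvR v : #|C :&: located loc [set v]| <= rk M (located loc [set v]).
  by rewrite -(eqP (iC v)) rk_mono // subsetIr.
have [|||B1 [sCB1 cB1 iB1 B1u]] := @enlarge_roots V S loc M C u1 (\sum_v u1 v) iC.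
- by move=> v; rewrite leq_maxr.
- by move=> v; rewrite geq_max f_r CvR.
- by rewrite leqnn andbT (card_at_sum loc C) leq_sum // => v _; rewrite leq_maxr.
(* The bounds [u1 v] add up to the size of [B1], so each of them is attained. *)
have B1E v : #|B1 :&: located loc [set v]| = u1 v.
  have := leqif_sum (fun v (_ : predT v) => leqif_eq (B1u v)).
  rewrite -(card_at_sum loc B1) cB1 => /leqif_refl/forall_inP/(_ v isT)/eqP //.
have u1b v : u1 v <= b v by rewrite geq_max Cb; case/andP: (bfg v) => ->.
pose u2 v := minn (rk M (located loc [set v])) (g v).
have u12 v : u1 v <= u2 v.
  rewrite leq_min geq_max f_r CvR /= (leq_trans (u1b v)) //; by case/andP: (bfg v).
(* The second enlargement reaches [alpha], adding nothing if [B1] is already that large. *)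
have [|||B [sB1B cB iB Bu]] := @enlarge_roots V S loc M B1 u2 (maxn alpha #|B1|) iB1.
- by move=> v; rewrite B1E.
- by move=> v; rewrite geq_minl.
- by rewrite leq_maxr geq_max le_a cB1 leq_sum.
have [|t [F [trim trees disF bases]]] := directed_packing hdH (@hverts_size V G) iB.
  move=> X X0; apply: leq_trans (Crk X X0) _; rewrite leq_add2l.
  by apply/rk_mono/setSI; apply: subset_trans sB1B.
pose a (i : 'I_#|B|) : S := enum_val i.
have aP (p : pred S) : [set a i | i : 'I_#|B| & p (a i)] = [set s in B | p s].
  apply/setP => s; rewrite inE; apply/imsetP/andP => [[i pi ->]|[sB ps]].
    by rewrite inE in pi; rewrite /a enum_valP.
  by exists (enum_rank_in sB s); rewrite ?inE /a enum_rankK_in.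
exists #|B|, (fun i => (loc (a i), F (a i))), t; split; first exact: trim.
split.
- split=> [i|i j ij]; first exact: trees.
  by apply: disF; apply: contra ij => /eqP/enum_val_inj ->.
- exists a; split=> [||v]; [exact: enum_val_inj | by [] |].
  by rewrite (aP (fun s => v \in tverts t (loc s, F s))).
- move=> v /=; rewrite -(card_imset _ (@enum_val_inj _ (mem B))).
  rewrite (aP (fun s => loc s == v)).
  have -> : [set s in B | loc s == v] = B :&: located loc [set v].
    by apply/setP => s; rewrite !inE.
  have := Bu v; rewrite leq_min => /andP[_ ->]; rewrite andbT.
  apply: (@leq_trans (u1 v)); first exact: leq_maxl.
  by rewrite -B1E; apply/subset_leq_card/setSI.
rewrite /limited cB leq_maxl geq_max le_ab cB1 /=.
by apply: leq_trans bT; rewrite vsumT leq_sum.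
Qed.

(** * Necessity: counting trees that enter the members of a partition *)

Lemma connect_exit (T : finType) (e : rel T) (A : {set T}) x y :
  connect e x y -> x \in A -> y \notin A -> exists a b, [/\ a \in A, b \notin A & e a b].
Proof.
case/connectP=> p + -> {y}; elim: p x => [|z p IH] x /=; first by move=> _ ->.
case/andP=> exz ezp xA; case: (boolP (z \in A)) => [zA|zA _]; first exact: IH ezp zA.
by exists x, z.
Qed.

(** Members are collected from the root's one on, with at most one more member than crossing edges
    inside their union. By connectivity a maximal such family covers the tree, and the root's member
    accounts for the one extra. *)
Lemma tree_crossing (V E : finType) (t : E -> {set V}) (T : V * {set E}) (P : {set {set V}}) :
  partition P [set: V] -> rooted_tree t T ->
  #|[set X in P | (X :&: tverts t T != set0) && (T.1 \notin X)]|
    <= #|[set e in T.2 | ~~ [exists X in P, t e \subset X]]|.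
Proof.
move=> pP [con _]; have tP := partition_trivIset pP.
have covP v : v \in cover P by rewrite (cover_partition pP) inE.
pose cr (W : {set {set V}}) :=
  [set e in T.2 | (t e \subset cover W) && ~~ [exists X in P, t e \subset X]].
pose p (W : {set {set V}}) := [&& W \subset P, T.1 \in cover W & #|W| <= #|cr W| + 1].
have [|W maxW _] := @maxset_exists _ p [set pblock P T.1].
  rewrite /p sub1set pblock_mem // cards1 addn1 ltnS leq0n andbT /=.
  by apply/bigcupP; exists (pblock P T.1); rewrite ?inE // mem_pblock.
have /and3P[WP xW leW] := maxsetp maxW.
have inW X y : X \in P -> y \in X -> y \in cover W -> X \in W.
  move=> XP yX /bigcupP[X' X'W yX'].
  by rewrite -(def_pblock tP XP yX) (def_pblock tP (subsetP WP _ X'W) yX').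
have Tcov y : y \in tverts t T -> y \in cover W.
  move=> yT; apply: contraT => nyW.
  have [a [b [aW nbW /exists_inP[e eF /eqP te]]]] := connect_exit (con y yT) xW nyW.
  pose X := pblock P b; have XP : X \in P by apply: pblock_mem.
  have bX : b \in X by rewrite mem_pblock.
  have nXW : X \notin W by apply: contra nbW => XW; apply/bigcupP; exists X.
  have covS : cover (X |: W) = X :|: cover W by rewrite /cover bigcup_setU big_set1.
  (* The edge leaving [cover W] is counted for [X |: W] but not for [W], which pays for the new
     member [X]. *)
  have pW : p (X |: W).
    rewrite /p subUset sub1set XP WP covS in_setU xW orbT /= cardsU1 nXW add1n addn1 ltnS.
    apply: leq_trans leW _; rewrite addn1; apply: proper_card; apply/properP; split.
      apply/subsetP => f; rewrite !inE covS => /and3P[-> sf ->]; rewrite andbT /=.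
      exact: subset_trans sf (subsetUr _ _).
    exists e; last first.
      rewrite inE te subUset !sub1set (negPf nbW) andbF /=; exact: negbT (andbF _).
    rewrite inE eF te covS subUset !sub1set !in_setU aW bX orbT /=.
    apply/exists_inPn => Z ZP; rewrite subUset !sub1set; apply: contra nbW => /andP[aZ bZ].
    by apply/bigcupP; exists Z => //; apply: inW aW.
  have eqW := maxsetsup maxW pW (subsetUr _ _).
  by rewrite -eqW setU11 in nXW.
have sub : [set X in P | (X :&: tverts t T != set0) && (T.1 \notin X)] \subset
    W :\ pblock P T.1.
  apply/subsetP => X; rewrite !inE => /and3P[XP /set0Pn[y] + nx].
  rewrite inE => /andP[yX /Tcov yW]; rewrite (inW X y) // andbT.
  by apply: contraNneq nx => ->; rewrite mem_pblock.
apply: leq_trans (subset_leq_card sub) _.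
have pW : pblock P T.1 \in W by apply: inW xW; rewrite ?pblock_mem // mem_pblock.
move: leW; rewrite (cardsD1 (pblock P T.1) W) pW addnC leq_add2r.
move/leq_trans; apply; apply/subset_leq_card/subsetP => e; rewrite !inE.
by case/and3P=> -> _ ->.
Qed.

Section Necessity.

Variables (V : finType) (G : hypergraph V) (S : finType) (loc : S -> V) (M : matroid S).
Variables (k : nat) (P : 'I_k -> V * {set hedge G}) (t : hedge G -> {set V}).
Hypotheses (trim : trimming t) (packing : tree_packing t P) (basedP : based t loc M P).

Local Notation r := (rk M [set: S]).

Definition reaching (X : {set V}) : nat :=
  #|[set i | (X :&: tverts t (P i) != set0) && ((P i).1 \notin X)]|.

Definition rooted_in (X : {set V}) : nat := #|[set i | (P i).1 \in X]|.

Lemma rooted_inE X : rooted_in X = \sum_(v in X) #|[set i | (P i).1 == v]|.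
Proof.
rewrite /rooted_in card_set_sum.
under [RHS]eq_bigr => v _ do rewrite card_set_sum.
rewrite exchange_big; apply: eq_bigr => i _ /=.
case: (boolP ((P i).1 \in X)) => [iX|niX].
  by rewrite (bigD1 (P i).1) //= eqxx big1 // => v /andP[_]; rewrite eq_sym => /negPf ->.
by rewrite big1 // => v vX; apply/eqP; rewrite eqb0; apply: contraNneq niX => ->.
Qed.

(** The crossing bound is summed over the trees. A trimmed edge crosses only if its hyperedge does,
    and no edge is in two trees. *)
Lemma sum_reaching (Q : {set {set V}}) : partition Q [set: V] ->
  \sum_(X in Q) reaching X <= cross G Q.
Proof.
move=> pQ; have [trees disj] := packing.
have -> : \sum_(X in Q) reaching X =
    \sum_i #|[set X in Q | (X :&: tverts t (P i) != set0) && ((P i).1 \notin X)]|.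
  under eq_bigr => X _ do rewrite /reaching card_set_sum.
  rewrite exchange_big /=; apply: eq_bigr => i _.
  by rewrite card_set_sum big_mkcond; apply: eq_bigr => X _; case: (X \in Q).
apply: (@leq_trans (\sum_i #|[set e in (P i).2 | ~~ [exists X in Q, t e \subset X]]|)).
  by apply: leq_sum => i _; apply: tree_crossing pQ (trees i).
under eq_bigr => i _ do rewrite card_set_sum.
rewrite exchange_big /cross card_set_sum; apply: leq_sum => e _ /=.
case: (boolP [exists X in Q, hverts e \subset X]) => [/exists_inP[X XQ eX]|_] /=.
  rewrite big1 // => i _; apply/eqP; rewrite eqb0 negb_and negbK; apply/orP; right.
  by apply/exists_inP; exists X => //; apply: subset_trans (trim e).1 eX.
case: (pickP (fun i => e \in (P i).2)) => [i ei|no].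
  rewrite (bigD1 i) //= big1 => [|j ji]; first by rewrite addn0 leq_b1.
  apply/eqP; rewrite eqb0 negb_and; apply/orP; left; apply/negP => ej.
  by have /pred0P/(_ e) := disj _ _ ji; rewrite /= ej ei.
by rewrite big1 // => i _; rewrite no.
Qed.

Lemma card_reaching_roots (a : 'I_k -> S) v (Y : {set V}) :
  injective a -> (forall i, loc (a i) = (P i).1) ->
  basis M [set a i | i : 'I_k & v \in tverts t (P i)] ->
  #|[set i | (v \in tverts t (P i)) && ((P i).1 \in Y)]| <= rk M (located loc Y).
Proof.
move=> inj_a la /basisP[iB _]; rewrite -(card_imset _ inj_a).
set D := [set a i | i in _]; have sDB : D \subset [set a i | i : 'I_k & v \in tverts t (P i)].
  by apply/imsetS/subsetP => i; rewrite !inE => /andP[].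
rewrite -(eqP (indepW sDB iB)); apply: rk_mono.
by apply/subsetP => _ /imsetP[i + ->]; rewrite !inE la => /andP[].
Qed.

(** Exactly r trees contain a fixed vertex of [X]. Their roots lie outside [X], in [X :\: Y], or in
    [Y]; the last kind carry independent elements located in [Y]. *)
Lemma rank_le_reaching (X Y : {set V}) : X != set0 -> Y \subset X ->
  r <= reaching X + rk M (located loc Y) + rooted_in (X :\: Y).
Proof.
move=> /set0Pn[v vX] sY; case: basedP => a [inj_a la /(_ v) bas].
have := card_reaching_roots Y inj_a la bas; have := card_basis bas.
rewrite card_imset // => <- le; rewrite -addnA addnCA addnC.
apply: leq_trans (leq_add (leqnn _) le); rewrite /reaching /rooted_in !card_set_sum -!big_split.
apply: leq_sum => i _ /=; case: (boolP (v \in tverts t (P i))) => //= vi.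
have -> : X :&: tverts t (P i) != set0 by apply/set0Pn; exists v; rewrite inE vX.
by rewrite inE; case: ((P i).1 \in X); case: ((P i).1 \in Y).
Qed.

Lemma necessity (f g : V -> nat) (alpha beta : nat) :
  bounded f g P -> limited alpha beta P ->
  [/\ forall v : V, f v <= minn (rk M (located loc [set v])) (g v),
      alpha <= beta,
      alpha <= \sum_(v : V) minn (rk M (located loc [set v])) (g v),
      forall Q : {set {set V}}, partition Q [set: V] ->
        (\sum_(X in Q) max_sub X (fun Y => r%:Z - (rk M (located loc Y))%:Z
                                   - (vsum g (X :\: Y))%:Z) <= (cross G Q)%:Z)%R
    & forall Q : {set {set V}}, partition Q [set: V] ->
        (\sum_(X in Q) max_sub X (fun Y => r%:Z - (rk M (located loc Y))%:Z
                                   + (vsum f Y)%:Z) <= beta%:Z + (cross G Q)%:Z)%R].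
Proof.
move=> bnd /andP[le_ak le_kb]; case: basedP => a [inj_a la bas].
have root_le v : #|[set i | (P i).1 == v]| <= minn (rk M (located loc [set v])) (g v).
  have /andP[_ le_g] := bnd v; rewrite leq_min le_g andbT.
  apply: leq_trans (card_reaching_roots [set v] inj_a la (bas v)).
  apply/subset_leq_card/subsetP => i; rewrite !inE => /eqP <-.
  by rewrite eqxx.
have roots_ge X : vsum f X <= rooted_in X.
  by rewrite rooted_inE leq_sum // => v _; case/andP: (bnd v).
have roots_le X : rooted_in X <= vsum g X.
  by rewrite rooted_inE leq_sum // => v _; case/andP: (bnd v).
have rootsT : rooted_in [set: V] = k.
  rewrite /rooted_in -[RHS]card_ord -cardsT; congr #|pred_of_set _|.
  by apply/setP => i; rewrite !inE.
split; [|exact: leq_trans le_ak le_kb| | |].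
- by move=> v; apply: leq_trans (root_le v); case/andP: (bnd v).
- apply: leq_trans le_ak _; rewrite -rootsT rooted_inE.
  by under eq_bigl => v do rewrite inE; apply: leq_sum.
- move=> Q pQ; apply: (@le_trans _ _ (Posz (\sum_(X in Q) reaching X))); last exact: sum_reaching.
  rewrite (big_morph Posz PoszD (erefl _)); apply: ler_sum => X XQ.
  have X0 : X != set0 by apply: contraTneq XQ => ->; case/and3P: pQ.
  apply: max_sub_leP => Y sY; have := rank_le_reaching X0 sY.
  by have := roots_le (X :\: Y); clear; lia.
(* The roots in the members of [Q] add up to [k], which is at most [beta]; within [X], the roots in
   [Y] are at least f(Y). *)
move=> Q pQ; apply: (@le_trans _ _ (Posz (\sum_(X in Q) (rooted_in X + reaching X)))); last first.
  rewrite big_split PoszD lerD //; last exact: sum_reaching.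
  have rE : \sum_(X in Q) rooted_in X = rooted_in [set: V].
    rewrite [RHS]rooted_inE (set_partition_big _ pQ) /=.
    by apply: eq_bigr => X _; rewrite rooted_inE.
  by rewrite rE rootsT.
rewrite (big_morph Posz PoszD (erefl _)); apply: ler_sum => X XQ.
have X0 : X != set0 by apply: contraTneq XQ => ->; case/and3P: pQ.
apply: max_sub_leP => Y sY; have := rank_le_reaching X0 sY; have := roots_ge Y.
have : rooted_in X = rooted_in Y + rooted_in (X :\: Y).
  by rewrite !rooted_inE -/(vsum _ X) -(vsumD _ sY).
by clear; lia.
Qed.

End Necessity.

Local Open Scope ring_scope.

Theorem theorem12 (V : finType) (G : hypergraph V) (S : finType) (loc : S -> V)
    (M : matroid S) (f g : V -> nat) (alpha beta : nat) :
  (exists (k : nat) (P : 'I_k -> V * {set hedge G}),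
     based_bounded_limited_hypertree_packing loc M f g alpha beta P)
  <->
  [/\ forall v : V, (f v <= minn (rk M (located loc [set v])) (g v))%N,
      (alpha <= beta)%N,
      (alpha <= \sum_(v : V) minn (rk M (located loc [set v])) (g v))%N,
      forall P : {set {set V}}, partition P [set: V] ->
        \sum_(X in P)
          max_sub X (fun Y => (rk M [set: S])%:Z - (rk M (located loc Y))%:Z
                              - (vsum g (X :\: Y))%:Z)
        <= (cross G P)%:Z
    & forall P : {set {set V}}, partition P [set: V] ->
        \sum_(X in P)
          max_sub X (fun Y => (rk M [set: S])%:Z - (rk M (located loc Y))%:Z
                              + (vsum f Y)%:Z)
        <= beta%:Z + (cross G P)%:Z].
Proof.
split=> [[k [P [t [trim [pack bas bnd lim]]]]]|[]]; first exact: necessity pack bas _ _ _ _ bnd lim.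
exact: sufficiency.
Qed.
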